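(* Let $F_N$ be the free group on $N\ge2$ generators, let $S$ be a finite generating set of $F_N$ and let $\nu_S$ be a Patterson–Sullivan measure for the word metric $d_S$ on the Gromov boundary $\partial F_N$. Then there exists $D>0$ such that for $\nu_S$-almost every $\xi\in\partial F_N$ there exists a $D$-rough geodesic ray $(\xi_k)_{k=0}^\infty$ for $d_S$ starting at the identity of $F_N$ with end point $\xi$ such that both of the following hold. (1) For every integer $m\ge1$ the set $\{[\xi_k]:k\ge m\}$ is spectrally rigid for Outer Space. (2) For every function $f:\mathbb{R}_{>0}\to\mathbb{R}_{>0}$ with $f(T)\to\infty$ as $T\to\infty$ there exists a subsequence $n_k$ such that $E=\{[\xi_{n_k}]:k\ge1\}$ is spectrally rigid for Outer Space and $$\#\{[x]\in E:\ell_S[x]<T\}\le f(T)\quad\text{for all }T>0.$$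
   Context: $o$ denotes the identity of $F_N$, $\mathrm{conj}(F_N)$ the set of conjugacy classes, $[x]$ the class of $x$. $d_S(x,y)$ is the minimal $k\ge0$ with $x^{-1}y=s_1\cdots s_k$, $s_i\in S\cup S^{-1}$, and $\ell_S[x]=\lim_{n\to\infty}d_S(o,x^n)/n$. $\mathrm{cv}_N$ denotes the (unprojectivized) Culler–Vogtmann Outer Space: its points are $F_N$-equivariant isometry classes of free, minimal, discrete isometric actions of $F_N$ on $\mathbb{R}$-trees. The length spectrum of $T\in\mathrm{cv}_N$ is the map sending $[x]\in\mathrm{conj}(F_N)$ to the translation length of $x$ on $T$. A set $E\subset\mathrm{conj}(F_N)$ is spectrally rigid for Outer Space if whenever $T_1,T_2\in\mathrm{cv}_N$ have the same length spectra on $E$, then $T_1=T_2$. A $D$-rough geodesic ray for $d_S$ is a sequence $(x_n)_{n\ge0}$ in $F_N$ with $|m-n|-D\le d_S(x_n,x_m)\le|m-n|+D$ for all $m,n$; its end point is its limit in $\partial F_N$. Patterson–Sullivan measure: let $v_S=\limsup_{T\to\infty}\frac1T\log\#\{x:d_S(o,x)<T\}$ and $\beta_o(x,\xi)=\sup\{\limsup_n(d_S(x,\xi_n)-d_S(o,\xi_n))\}$, supremum over sequences $(\xi_n)$ in $F_N$ converging to $\xi\in\partial F_N$. A Patterson–Sullivan measure for $d_S$ is a Borel probability measure $\nu$ on $\partial F_N$ for which there is $C>1$ with $C^{-1}e^{-v_S\beta_o(x,\xi)}\le\frac{dx_\ast\nu}{d\nu}(\xi)\le Ce^{-v_S\beta_o(x,\xi)}$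 for all $x\in F_N$ and $\nu$-a.e. $\xi$. *)

(* Defs.v *)
From HB Require Import structures.
From mathcomp Require Import all_boot all_order all_algebra finmap.
From mathcomp Require Import generic_quotient zify lra.
From mathcomp Require Import all_classical all_reals all_analysis.

Set Implicit Arguments.
Unset Strict Implicit.
Unset Printing Implicit Defensive.

Import Order.TTheory GRing.Theory Num.Theory.
Import numFieldNormedType.Exports.

Local Open Scope classical_set_scope.
Local Open Scope ring_scope.

Section FreeGroup.
Variable N : nat.

(* (i, true) is the i-th generator and (i, false) is its inverse. *)
Definition letter : Type := ('I_N * bool)%type.

Definition letter_inv (a : letter) : letter := (a.1, ~~ a.2).

Definition reduced (w : seq letter) : bool :=
  sorted (fun a b : letter => b != letter_inv a) w.

Definition free_group : Type := {w : seq letter | reduced w}.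

HB.instance Definition _ := Choice.on free_group.

(* The reduced form of a :: w, for w reduced. *)
Definition push (a : letter) (w : seq letter) : seq letter :=
  if w is b :: w' then if b == letter_inv a then w' else a :: w else [:: a].

Lemma letter_invK : involutive letter_inv.
Proof. by case=> i b; rewrite /letter_inv /= negbK. Qed.

Lemma reduced_behead a w : reduced (a :: w) -> reduced w.
Proof. exact: path_sorted. Qed.

Lemma push_reduced a w : reduced w -> reduced (push a w).
Proof.
case: w => [//|b w] /= rw; case: ifPn => [_|ba].
  exact: (reduced_behead rw).
by rewrite /= ba.
Qed.

Lemma pushE a w : reduced (a :: w) -> push a w = a :: w.
Proof. by case: w => [//|b w] /= /andP[/negbTE ->]. Qed.

Lemma pushK a w : reduced w -> push a (push (letter_inv a) w) = w.
Proof.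
case: w => [_|b w rw] /=; first by rewrite eqxx.
rewrite letter_invK; case: eqVneq => [ba|ba] /=; last by rewrite eqxx.
by rewrite -ba pushE.
Qed.

Definition mulw (u v : seq letter) : seq letter := foldr push v u.

Lemma mulw_reduced u v : reduced v -> reduced (mulw u v).
Proof. by move=> rv; elim: u => [//|a u IHu] /=; exact: push_reduced. Qed.

Lemma mulw_push a u v : reduced v -> mulw (push a u) v = push a (mulw u v).
Proof.
move=> rv; case: u => [//|b u] /=; case: eqVneq => [->|//].
by rewrite pushK // mulw_reduced.
Qed.

Lemma mulwA u v w : reduced w -> mulw u (mulw v w) = mulw (mulw u v) w.
Proof. by move=> rw; elim: u => [//|a u IHu] /=; rewrite mulw_push // IHu. Qed.

Lemma mulw0 w : reduced w -> mulw w [::] = w.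
Proof.
elim: w => [//|a w IHw] rw /=.
by rewrite IHw ?pushE //; exact: reduced_behead rw.
Qed.

Definition invw (w : seq letter) : seq letter := rev (map letter_inv w).

Lemma invwK : involutive invw.
Proof. by move=> w; rewrite /invw map_rev revK (mapK letter_invK). Qed.

Lemma invw_reduced w : reduced w -> reduced (invw w).
Proof.
rewrite /reduced /invw rev_sorted sorted_map; apply: sub_sorted => a b ba.
by apply: contra ba => /eqP /= ab; rewrite -[b]letter_invK -ab.
Qed.

Lemma mulVw w : mulw (invw w) w = [::].
Proof.
elim: w => [//|a w IHw].
by rewrite /invw /= rev_cons /mulw foldr_rcons /= letter_invK eqxx.
Qed.

Definition fg1 : free_group := exist _ [::] isT.
Definition fgM (x y : free_group) : free_group :=
  Sub (mulw (val x) (val y)) (mulw_reduced (val x) (valP y)).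
Definition fgV (x : free_group) : free_group :=
  Sub (invw (val x)) (invw_reduced (valP x)).

Lemma fgMA : associative fgM.
Proof. by move=> x y z; apply/val_inj/mulwA/valP. Qed.
Lemma fgM1x : left_id fg1 fgM.
Proof. by move=> x; exact/val_inj. Qed.
Lemma fgMx1 : right_id fg1 fgM.
Proof. by move=> x; apply/val_inj/mulw0/valP. Qed.
Lemma fgMVx : left_inverse fg1 fgV fgM.
Proof. by move=> x; apply/val_inj/mulVw. Qed.
Lemma fgMxV : right_inverse fg1 fgV fgM.
Proof.
by move=> x; apply/val_inj; rewrite /= -[X in mulw X _]invwK mulVw.
Qed.

HB.instance Definition _ :=
  isGroup.Build free_group fgMA fgM1x fgMx1 fgMVx fgMxV.

Definition fg_gen (i : 'I_N) : free_group :=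
  exist _ [:: (i, true)] isT.

Definition fg_basis : {fset free_group} := [fset fg_gen i | i in 'I_N]%fset.

End FreeGroup.

Section WordMetric.
Variables (G : groupType) (S : {fset G}).
Implicit Types (x y g : G) (w : seq G) (k : nat).

Definition is_word w : bool := all (fun s => (s \in S) || (s^-1%g \in S)) w.

Definition generates : Prop :=
  forall x, exists2 w, is_word w & (\prod_(s <- w) s)%g = x.

Definition word_of_length g : pred nat := fun k =>
  `[< exists w, [/\ size w = k, is_word w & (\prod_(s <- w) s)%g = g] >].

(* The value 0 is a dummy, for g not in the subgroup generated by S. *)
Definition word_length g : nat :=
  match pselect (exists k, word_of_length g k) with
  | left h => ex_minn h
  | right _ => 0%N
  end.

Definition word_dist x y : nat := word_length (x^-1 * y)%g.

Lemma word_length_le w g : is_word w -> (\prod_(s <- w) s)%g = g ->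
  (word_length g <= size w)%N.
Proof.
move=> ww wg; have gw : word_of_length g (size w) by apply/asboolP; exists w.
rewrite /word_length; case: pselect => // h.
by case: ex_minnP => k _; apply.
Qed.

Hypothesis genS : generates.

Lemma word_lengthP g : word_of_length g (word_length g).
Proof.
rewrite /word_length; case: pselect => [h|[]]; first by case: ex_minnP.
by have [w ww wg] := genS g; exists (size w); apply/asboolP; exists w.
Qed.

Lemma word_lengthM g h : (word_length (g * h)%g <= word_length g + word_length h)%N.
Proof.
have /asboolP[u [<- uw ug]] := word_lengthP g.
have /asboolP[v [<- vw vh]] := word_lengthP h.
rewrite -size_cat; apply: word_length_le; first by rewrite /is_word all_cat; apply/andP.
by rewrite big_cat /= ug vh.
Qed.

End WordMetric.

Section ConjugacyClasses.
Variable G : groupType.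

Definition conjugate (x y : G) : bool := `[< exists g, y = (x ^ g)%g >].

Lemma conjugate_equiv : equiv_class_of conjugate.
Proof.
split=> [x|x y|y x z].
- by apply/asboolP; exists 1%g; rewrite conjg1.
- by apply: asbool_equiv_eq; split=> -[g ->]; exists g^-1%g;
    rewrite -conjgM mulgV conjg1.
- move=> /asboolP[g ->] /asboolP[h ->].
  by apply/asboolP; exists (g * h)%g; rewrite conjgM.
Qed.

Canonical conjugate_equivRel := EquivRelPack conjugate_equiv.

Definition conj_classes : Type := {eq_quot conjugate}%qT.

HB.instance Definition _ := Choice.on conj_classes.
HB.instance Definition _ := Quotient.on conj_classes.

Definition conj_class (x : G) : conj_classes := (\pi_conj_classes x)%qT.

End ConjugacyClasses.

Definition stable_length (R : realType) (G : groupType) (S : {fset G})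
    (c : conj_classes G) : R :=
  limn (fun n : nat => (word_dist S 1%g (repr c ^+ n)%g)%:R / n%:R : R).

Section GromovBoundary.
Variables (G : groupType) (S : {fset G}).
Implicit Types (s t : nat -> G) (x y : G).

Definition gromov_product x y : rat :=
  ((word_dist S 1%g x)%:R + (word_dist S 1%g y)%:R - (word_dist S x y)%:R) / 2.

(* gromov_div s t says that (s_i | t_j) tends to infinity as i, j do.
   So s converges to infinity when gromov_div s s, and two sequences which
   converge to infinity are equivalent when gromov_div s t. *)
Definition gromov_div s t : Prop :=
  forall M : rat, exists n : nat, forall i j, (n <= i)%N -> (n <= j)%N ->
    M <= gromov_product (s i) (t j).

Definition gromov_class s : set (nat -> G) :=
  [set t | gromov_div t t /\ gromov_div s t].

Record gromov_boundary : Type := GromovBoundary {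
  boundary_class : set (nat -> G);
  boundary_classP :
    exists2 s, gromov_div s s & boundary_class = gromov_class s }.

HB.instance Definition _ := gen_eqMixin gromov_boundary.
HB.instance Definition _ := gen_choiceMixin gromov_boundary.

Definition converges_to s (xi : gromov_boundary) : Prop := boundary_class xi s.

(* The Gromov product takes values in (1/2)Z, so "eventually at least r" is
   the same as "the lower limit is at least r". *)
Definition boundary_nbhd (xi : gromov_boundary) (r : rat) :
    set gromov_boundary :=
  [set eta | exists s t, [/\ converges_to s xi, converges_to t eta &
    exists n : nat, forall i j, (n <= i)%N -> (n <= j)%N ->
      r <= gromov_product (s i) (t j)]].

Definition boundary_open (O : set gromov_boundary) : Prop :=
  forall xi, O xi -> exists r, boundary_nbhd xi r `<=` O.

Lemma boundary_nbhdS xi r r' : r <= r' ->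
  boundary_nbhd xi r' `<=` boundary_nbhd xi r.
Proof.
move=> rr' eta [s [t [sxi teta [n nP]]]]; exists s, t; split=> //.
by exists n => i j ni nj; rewrite (le_trans rr') ?nP.
Qed.

Lemma boundary_openT : boundary_open setT.
Proof. by move=> xi _; exists 0. Qed.

Lemma boundary_openI : setI_closed boundary_open.
Proof.
move=> A B oA oB xi [/oA[r rA] /oB[r' rB]]; exists (Num.max r r').
by move=> eta xieta; split; [apply: rA|apply: rB];
  apply: boundary_nbhdS xieta; rewrite le_max lexx ?orbT.
Qed.

Lemma boundary_open_bigU (I : Type) (f : I -> set gromov_boundary) :
  (forall i, boundary_open (f i)) -> boundary_open (\bigcup_i f i).
Proof.
move=> fo xi [i _ /fo[r rf]]; exists r.
by move=> eta /rf; exists i.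
Qed.

HB.instance Definition _ := isOpenTopological.Build gromov_boundary
  boundary_openT boundary_openI boundary_open_bigU.

Lemma boundary_openE : @open gromov_boundary = boundary_open.
Proof. by []. Qed.

Hypothesis genS : generates S.

Lemma gromov_product_translate g x y :
  gromov_product x y - (word_length S g^-1)%:R
    <= gromov_product (g * x)%g (g * y)%g.
Proof.
have le_len z : (word_dist S 1%g z)%:R
    <= (word_length S g^-1)%:R + (word_dist S 1%g (g * z)%g)%:R :> rat.
  rewrite -natrD ler_nat /word_dist !invg1 !mul1g.
  by rewrite -[in X in (X <= _)%N](mulKg g z) word_lengthM.
have -> : gromov_product (g * x)%g (g * y)%g =
    ((word_dist S 1%g (g * x)%g)%:R + (word_dist S 1%g (g * y)%g)%:R
      - (word_dist S x y)%:R) / 2.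
  by rewrite /gromov_product {3}/word_dist invgM mulgA -(mulgA _ _ g) mulVg mulg1.
move: (le_len x) (le_len y); rewrite /gromov_product; lra.
Qed.

Lemma gromov_div_translate g s t : gromov_div s t ->
  gromov_div (fun n => g * s n)%g (fun n => g * t n)%g.
Proof.
move=> st M; have [n nP] := st (M + (word_length S g^-1)%:R).
exists n => i j ni nj; apply: le_trans (gromov_product_translate g _ _).
by rewrite lerBrDr nP.
Qed.

Lemma gromov_class_translate g s :
  [set (fun n => g * t n)%g | t in gromov_class s] =
    gromov_class (fun n => g * s n)%g.
Proof.
apply/seteqP; split=> [_ [t [tt st] <-]|t [tt st]].
  by split; exact: gromov_div_translate.
exists (fun n => g^-1 * t n)%g; last by apply/funext => n; rewrite mulVKg.
split; first exact: gromov_div_translate.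
rewrite (_ : s = (fun n => g^-1 * (g * s n))%g); first exact: gromov_div_translate.
by apply/funext => n; rewrite mulKg.
Qed.

Lemma boundary_act_subproof g (xi : gromov_boundary) :
  exists2 s, gromov_div s s &
    [set (fun n => g * t n)%g | t in boundary_class xi] = gromov_class s.
Proof.
have [s ss ->] := boundary_classP xi; exists (fun n => g * s n)%g.
  exact: gromov_div_translate.
exact: gromov_class_translate.
Qed.

Definition boundary_act g (xi : gromov_boundary) : gromov_boundary :=
  GromovBoundary (boundary_act_subproof g xi).

Lemma boundary_act_open g (O : set gromov_boundary) :
  open O -> open (boundary_act g @^-1` O).
Proof.
rewrite boundary_openE => oO xi /= /oO[r rO]; exists (r + (word_length S g^-1)%:R).
move=> eta [s [t [sxi teta [n nP]]]] /=; apply: rO.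
exists (fun n => g * s n)%g, (fun n => g * t n)%g; split.
- by exists s.
- by exists t.
- exists n => i j ni nj; apply: le_trans (gromov_product_translate g _ _).
  by rewrite lerBrDr nP.
Qed.

End GromovBoundary.

Section FreeGroupBoundary.
Variable N : nat.
Local Notation F := (free_group N).

Lemma mem_fg_basis i : fg_gen i \in fg_basis N.
Proof. by apply/imfsetP; exists i. Qed.

Lemma fg_basis_generates : generates (fg_basis N).
Proof.
move=> x; elim: {x}(val x) {-2}x (erefl (val x)) => [|[i b] w IHw] x xE.
  by exists [::] => //; rewrite big_nil; exact/val_inj.
have rw : reduced w by move: (valP x); rewrite xE; exact: reduced_behead.
have [v vw vE] := IHw (Sub w rw) erefl.
exists ((if b then fg_gen i else (fg_gen i)^-1)%g :: v).
  apply/andP; split=> //; case: b {xE} => /=; first by rewrite mem_fg_basis.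
  by rewrite invgK mem_fg_basis orbT.
rewrite big_cons vE; apply/val_inj; rewrite xE.
by case: b xE => xE; rewrite /= pushE // -xE; exact: valP.
Qed.

Lemma size_push (a : letter N) w : (size (push a w) <= (size w).+1)%N.
Proof. by case: w => [//|b w] /=; case: ifP => //= _; exact: leqW. Qed.

Lemma size_fg (w : seq F) : is_word (fg_basis N) w ->
  (size (val (\prod_(s <- w) s)%g) <= size w)%N.
Proof.
elim: w => [|s w IHw]; first by rewrite big_nil.
rewrite /is_word big_cons /= => /andP[/orP ss /IHw {}IHw].
suff [a sa] : exists a, val s = [:: a].
  by rewrite sa /=; apply: leq_trans (size_push _ _) _.
case: ss => /imfsetP[i _ si]; first by exists (i, true); rewrite si.
by exists (i, false); rewrite -[s]invgK si.
Qed.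

Lemma val_fg_genX i n : val (fg_gen i ^+ n : F)%g = nseq n (i, true).
Proof.
elim: n => [//|n IHn]; rewrite expgS /= IHn; case: n {IHn} => [//|n] /=.
by case: eqVneq.
Qed.

Lemma word_length_genX i n : word_length (fg_basis N) (fg_gen i ^+ n)%g = n.
Proof.
apply/eqP; rewrite eqn_leq; apply/andP; split.
  rewrite -[leqRHS](size_nseq n (fg_gen i)); apply: word_length_le.
    by apply/allP => s /nseqP[-> _]; rewrite mem_fg_basis.
  by elim: n => [|n IHn]; rewrite ?big_nil //= big_cons IHn expgS.
have /asboolP[w [<- ww wE]] := word_lengthP fg_basis_generates (fg_gen i ^+ n)%g.
by rewrite -[leqLHS](size_nseq n (i, true)) -val_fg_genX -wE size_fg.
Qed.

Lemma word_length_genV i n :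
  (word_length (fg_basis N) (fg_gen i ^+ n)^-1%g <= n)%N.
Proof.
rewrite -[leqRHS](size_nseq n (fg_gen i)^-1%g); apply: word_length_le.
  by apply/allP => s /nseqP[-> _]; rewrite invgK mem_fg_basis orbT.
rewrite -expVgn.
by elim: n => [|n IHn]; rewrite ?big_nil //= big_cons IHn expgS.
Qed.

Lemma gromov_div_genX i : gromov_div (fg_basis N)
  (fun n => fg_gen i ^+ n)%g (fun n => fg_gen i ^+ n)%g.
Proof.
move=> M; have [n Mn] : exists n : nat, M <= n%:R.
  exists (Num.truncn `|M|).+1; rewrite (le_trans (ler_norm M)) //.
  by rewrite ltW // truncnS_gt.
exists n => k l nk nl; apply: (le_trans Mn).
rewrite /gromov_product /word_dist !invg1 !mul1g !word_length_genX.
rewrite ler_pdivlMr // -natrM -natrD lerBrDr -natrD ler_nat muln2 -addnn.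
have [kl|/ltnW lk] := leqP k l.
  rewrite -(subnKC kl) expgnDr mulKg word_length_genX.
  by rewrite !addnA leq_add2r leq_add.
rewrite -(subnKC lk) expgnDr invgM -mulgA mulVg mulg1 subnKC //.
move: (word_length _ _) (word_length_genV i (k - l)%N) => e; lia.
Qed.

End FreeGroupBoundary.

(* The boundary of F_N, computed in the Cayley graph of the standard basis; the
   Gromov boundary of a hyperbolic group does not depend on this choice. The
   hypothesis on N makes it nonempty, as measurable types must be. *)
Definition boundary (N : nat) (N_ge2 : (2 <= N)%N) : Type :=
  gromov_boundary (fg_basis N).

Section BorelBoundary.
Variables (N : nat) (N_ge2 : (2 <= N)%N).

HB.instance Definition _ := Topological.on (boundary N_ge2).

Let base_ray (n : nat) : free_group N :=
  (fg_gen (Ordinal (ltnW N_ge2)) ^+ n)%g.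

Lemma boundary_point_subproof :
  exists2 s, gromov_div (fg_basis N) s s &
    gromov_class (fg_basis N) base_ray = gromov_class (fg_basis N) s.
Proof. by exists base_ray => //; exact: gromov_div_genX. Qed.

HB.instance Definition _ := isPointed.Build (boundary N_ge2)
  (GromovBoundary boundary_point_subproof).

HB.instance Definition _ := Measurable.copy (boundary N_ge2)
  (g_sigma_algebraType (@open (boundary N_ge2))).

Definition bact (g : free_group N) (xi : boundary N_ge2) : boundary N_ge2 :=
  boundary_act (@fg_basis_generates N) g xi.

Lemma bact_measurable g : measurable_fun setT (bact g).
Proof.
apply: (measurability (@open (boundary N_ge2))) => //.
move=> _ [U oU <-]; rewrite setTI.
by apply: sub_sigma_algebra; exact: boundary_act_open.
Qed.

HB.instance Definition _ g :=
  isMeasurableFun.Build _ _ _ _ (bact g) (@bact_measurable g).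

End BorelBoundary.

Section PattersonSullivan.
Variables (R : realType) (N : nat) (N_ge2 : (2 <= N)%N).
Variable S : {fset free_group N}.
Local Notation d := (word_dist S).

Definition growth_rate : R :=
  fine (limf_esup (fun T : R =>
    (ln (#|` fset_set [set x | (d 1%g x)%:R < T]|%fset%:R) / T)%:E)
    (pinfty_nbhs R)).

Definition busemann (x : free_group N) (xi : boundary N_ge2) : R :=
  fine (ereal_sup
    [set limn_esup (fun n => ((d x (s n))%:R - (d 1%g (s n))%:R)%:E)
      | s in [set s | converges_to s xi]]).

Definition patterson_sullivan (nu : probability (boundary N_ge2) R) : Prop :=
  exists2 C : R, 1 < C & forall x : free_group N,
    distribution nu (bact x) `<< nu /\
    {ae nu, forall xi,
      ((C^-1 * expR (- growth_rate * busemann x xi))%:E <=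
        Radon_Nikodym (charge_of_finite_measure (distribution nu (bact x))) nu xi <=
        (C * expR (- growth_rate * busemann x xi))%:E)%E}.

End PattersonSullivan.

Section RoughGeodesics.
Variables (R : realType) (G : groupType) (S : {fset G}).

Definition rough_geodesic_ray (D : R) (x : nat -> G) : Prop :=
  forall m n : nat,
    `|m%:R - n%:R| - D <= (word_dist S (x n) (x m))%:R <= `|m%:R - n%:R| + D.

End RoughGeodesics.

(* In a nonempty metric space: any two points are joined by a unique arc, and
   that arc is a geodesic segment. *)
Definition is_real_tree (R : realType) (T : metricType R) : Prop :=
  [set: T] !=set0 /\
  forall x y : T, exists gamma : R -> T,
    [/\ gamma 0 = x, gamma (mdist x y) = y,
        {in `[0, mdist x y] &, forall s t, mdist (gamma s) (gamma t) = `|s - t|} &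
        forall c : R -> T, {within `[0, 1], continuous c} ->
          {in `[0, 1] &, injective c} -> c 0 = x -> c 1 = y ->
          c @` `[0, 1] = gamma @` `[0, mdist x y]].

Record outer_tree (R : realType) (N : nat) := OuterTree {
  ot_space :> metricType R;
  ot_act : free_group N -> ot_space -> ot_space;
  ot_real_tree : is_real_tree ot_space;
  ot_act1 : forall p, ot_act 1%g p = p;
  ot_actM : forall g h p, ot_act (g * h)%g p = ot_act g (ot_act h p);
  ot_isometric : forall g p q, mdist (ot_act g p) (ot_act g q) = mdist p q;
  ot_free : forall g p, ot_act g p = p -> g = 1%g;
  (* The subtrees of an R-tree are its nonempty connected subsets. *)
  ot_minimal : forall A : set ot_space, A !=set0 -> connected A ->
    (forall g p, A p -> A (ot_act g p)) -> A = setT;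
  (* Every orbit is a discrete subset. *)
  ot_discrete : forall p, exists2 e : R, 0 < e &
    forall g, mdist p (ot_act g p) < e -> ot_act g p = p }.

Section OuterSpace.
Variables (R : realType) (N : nat).
Local Notation F := (free_group N).

(* Equality of the points of Outer Space represented by T1 and T2. *)
Definition outer_eq (T1 T2 : outer_tree R N) : Prop :=
  exists phi : T1 -> T2, [/\ set_bij setT setT phi,
    forall p q, mdist (phi p) (phi q) = mdist p q &
    forall g p, phi (ot_act g p) = ot_act g (phi p)].

Definition translation_length (T : outer_tree R N) (x : F) : R :=
  inf [set mdist p (ot_act x p) | p in [set: T]].

Definition length_spectrum (T : outer_tree R N) (c : conj_classes F) : R :=
  translation_length T (repr c).

Definition spectrally_rigid (E : set (conj_classes F)) : Prop :=
  forall T1 T2 : outer_tree R N,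
    (forall c, E c -> length_spectrum T1 c = length_spectrum T2 c) ->
    outer_eq T1 T2.

End OuterSpace.

(* Main.v *)
Require Import Defs.
From HB Require Import structures.
From mathcomp Require Import all_boot all_order all_algebra finmap.
From mathcomp Require Import zify lra.
From mathcomp Require Import all_classical all_reals all_analysis
  measurable_realfun.

Set Implicit Arguments.
Unset Strict Implicit.
Unset Printing Implicit Defensive.

Import Order.TTheory GRing.Theory Num.Theory.
Import numFieldNormedType.Exports.

Local Open Scope classical_set_scope.
Local Open Scope ring_scope.

(** Every prefix of an infinite reduced word which ends with a letter that
    does not cancel against the first one is cyclically reduced, and for such
    words [w] the translation length on a tree [T] of Outer Space agrees with
    the displacement [L_T w] of a base point up to a constant [C(T)]
    ([translation_length_ge]), by bounded cancellation ([displ_cat]). So if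
    two prefixes [w] and [w v] of the ray both have their classes in [E], then
    the length spectrum on [E] determines [L_T v] up to a bounded error.

    The measure enters through [words_recur]: by the shadow lemma a definite
    proportion of every cylinder continues with a given word, so that almost
    every infinite word contains all finite words infinitely often. The
    infinite word of such a point is turned into a rough geodesic ray for [S]
    by keeping the first prefix of [S]-length at least [k], for each [k]
    ([rough_ray]). The ray may jump over some prefixes, but at most boundedly
    many in a row; each [v] is therefore looked for in the form [c^L v c^L],
    where the powers of the letter [c] contain points of the ray and make
    these prefixes cyclically reduced ([ray_differ_by]). For each [v] two
    elements of the ray are enough, and they may be taken as far away as
    desired, where the stable lengths are large. This is why the set [E] may
    be as sparse as any function [f] demands ([sparse_subsequence]).

    It remains to see that two trees with [L_1 - L_2] bounded on the whole
    group are equal ([bounded_difference_eq]). When a long word [p] is inside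
    a reduced word [u p v], the four-point condition in a tree gives the exact
    relation [L (u p v) = L (u p) + L (p v) - L p], which [L_1 - L_2]
    inherits. A bounded function with this property cannot change when one
    winds along a loop ([delta_loop]). It follows that [L_1 - L_2] is constant
    on the pairs of points near two given ends of the tree, and that these
    constants form a coboundary ([delta_flanked]). The base point is taken to
    be the branch point of three words which diverge at once. Prolonging the
    words does not move it ([median_prolong]), so the distances between its
    translates can be computed from points near the ends ([median_dist]);
    there the constants cancel, and the orbits in the two trees are isometric.
    As the trees are minimal, the segments between the points of an orbit
    cover them, and the isometry extends ([orbit_isometry]). *)

(** * Reduced words *)

Section Words.
Variable N : nat.
Local Notation F := (free_group N).
Local Notation word := (seq (letter N)).
Implicit Types (a b : letter N) (c u v w p q : word) (x y g h : F).

(** The element represented by a word which need not be reduced. *)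
Definition fgw w : F := exist _ (mulw w [::]) (@mulw_reduced N w [::] isT).

Lemma val_fgw w : reduced w -> val (fgw w) = w.
Proof. exact: mulw0. Qed.

Lemma fgw_val x : fgw (val x) = x.
Proof. by apply/val_inj/val_fgw/valP. Qed.

Lemma fgw_cat u v : fgw (u ++ v) = (fgw u * fgw v)%g.
Proof.
apply/val_inj; rewrite /= -mulwA; last exact: (@mulw_reduced N v [::] isT).
by rewrite /mulw foldr_cat.
Qed.

Lemma fgw0 : fgw [::] = 1%g.
Proof. exact/val_inj. Qed.

Lemma reduced_catl u v : reduced (u ++ v) -> reduced u.
Proof. by case: u => // a u; rewrite /reduced /= cat_path => /andP[]. Qed.

Lemma reduced_catr u v : reduced (u ++ v) -> reduced v.
Proof. by elim: u => //= a u IHu /reduced_behead/IHu. Qed.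

Lemma reduced_cat3 u v w :
  reduced (u ++ v) -> reduced (v ++ w) -> v != [::] -> reduced (u ++ v ++ w).
Proof.
case: v => // a v; case: u => // b u; rewrite /reduced /= !cat_path /=.
by move=> /and3P[-> -> _]; rewrite !cat_path.
Qed.

Lemma invw_cat u v : invw (u ++ v) = invw v ++ invw u.
Proof. by rewrite /invw map_cat rev_cat. Qed.

Lemma size_invw u : size (invw u) = size u.
Proof. by rewrite /invw size_rev size_map. Qed.

Lemma reduced_invw u : reduced (invw u) = reduced u.
Proof. by apply/idP/idP => /invw_reduced; rewrite ?invwK. Qed.

Lemma mulwVr u v : reduced v -> mulw u (mulw (invw u) v) = v.
Proof. by move=> rv; rewrite mulwA //; have := mulVw (invw u); rewrite invwK =>
  ->. Qed.

Lemma fgw_inv u : fgw (invw u) = (fgw u)^-1%g.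
Proof.
apply/(mulgI (fgw u)); rewrite mulgV -fgw_cat; apply/val_inj => /=.
by rewrite /mulw foldr_cat -/(mulw _ _) -/(mulw (invw u) _) mulwVr.
Qed.

(** In the tree of reduced words [c] is where the paths from 1 to [x] and to
    [y] separate, and the path from [x] to [y] reads [u^-1 v]. *)
Lemma common_prefix x y : exists c u v,
  [/\ val x = c ++ u, val y = c ++ v & reduced (invw u ++ v)].
Proof.
suff H p q : reduced p -> reduced q ->
    exists c u v, [/\ p = c ++ u, q = c ++ v & reduced (invw u ++ v)].
  exact: H (valP x) (valP y).
elim: p q => [|a p IHp] q rp rq; first by exists [::], [::], q; split.
case: q rq => [|b q] rq.
  by exists [::], (a :: p), [::]; split; rewrite ?cats0 ?reduced_invw.
have [ab|ab] := eqVneq a b.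
  have [c [u [v [-> -> ruv]]]] := IHp q (reduced_behead rp) (reduced_behead rq).
  by exists (a :: c), u, v; rewrite ab.
exists [::], (a :: p), (b :: q); split=> //.
rewrite (_ : invw (a :: p) = invw p ++ [:: letter_inv a]); last first.
  by rewrite /invw /= rev_cons cats1.
rewrite -catA; apply: reduced_cat3 => //.
  rewrite (_ : _ ++ _ = invw (a :: p)) ?reduced_invw //.
  by rewrite /invw /= rev_cons cats1.
by apply/andP; rewrite letter_invK eq_sym ab.
Qed.

Definition fgsize x : nat := size (val x).

Lemma fgsize_fgw w : reduced w -> fgsize (fgw w) = size w.
Proof. by move=> rw; rewrite /fgsize val_fgw. Qed.

Lemma fgsizeV x : fgsize x^-1%g = fgsize x.
Proof. exact: size_invw. Qed.

Lemma size_mulw u v : (size (mulw u v) <= size u + size v)%N.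
Proof. by elim: u => //= a u IHu; rewrite (leq_trans (size_push _ _)). Qed.

Lemma fgsizeM x y : (fgsize (x * y)%g <= fgsize x + fgsize y)%N.
Proof. exact: size_mulw. Qed.

Lemma fgVM_common c u v :
  ((fgw (c ++ u))^-1 * fgw (c ++ v))%g = fgw (invw u ++ v).
Proof. by rewrite !fgw_cat fgw_inv invgM -mulgA mulKg. Qed.

(** Removing [u] from the tree of reduced words cuts off the words which
    extend it, so the path from [g] to [h] has to visit [u]. *)
Lemma fgsize_separate u g h : prefix u (val h) -> ~~ prefix u (val g) ->
  (fgsize (g^-1 * fgw u)%g <= fgsize (g^-1 * h)%g)%N.
Proof.
move=> /prefixP[w hE] ug; have ruw : reduced (u ++ w) by rewrite -hE;
  exact: valP.
have [c [p [q [gE uE rpq]]]] := common_prefix g (fgw u).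
move: uE; rewrite val_fgw ?(reduced_catl ruw) // => uE.
have q0 : q != [::].
  by apply: contraNneq ug => q0; rewrite gE uE q0 cats0 prefix_prefix.
rewrite -(fgw_val g) -(fgw_val h) hE gE uE -catA !fgVM_common.
rewrite !fgsize_fgw // ?catA ?size_cat ?leq_addr //.
rewrite -catA reduced_cat3 // .
by apply: (@reduced_catr c); rewrite catA -uE.
Qed.

(** Since [u] separates 1 from [u v], a chain of elements from one to the
    other with jumps at most [B] has to come [B]-close to [u]. *)
Lemma chain_near_prefix (s : nat -> F) (k B : nat) u v :
    reduced (u ++ v) -> s 0%N = 1%g -> s k = fgw (u ++ v) ->
    (forall i, (i < k)%N -> (fgsize ((s i)^-1 * s i.+1)%g <= B)%N) ->
  exists2 i, (i <= k)%N & (fgsize ((s i)^-1 * fgw u)%g <= B)%N.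
Proof.
move=> ruv s0 sk jump; case: u ruv sk => [|a u] ruv sk.
  by exists 0%N; rewrite // s0 fgw0 invg1 mulg1.
have [i ik si] : exists2 i, (i < k)%N &
    prefix (a :: u) (val (s i.+1)) && ~~ prefix (a :: u) (val (s i)).
  have : prefix (a :: u) (val (s k)) by rewrite sk val_fgw ?prefix_prefix.
  elim: {sk} k jump => [|k IHk] jump; first by rewrite s0.
  move=> pk; have [pk'|pk'] := boolP (prefix (a :: u) (val (s k))).
    have [|i ik ?] := IHk _ pk'; first by move=> i ik; exact/jump/leqW.
    by exists i => //; exact: leqW.
  by exists k => //; rewrite pk.
exists i; first exact: ltnW.
by move: si => /andP[+ /fgsize_separate h] => /h /leq_trans; apply; exact: jump.
Qed.
Lemma reduced_diverge a b u v : a != b -> reduced (a :: u) ->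
  reduced (b :: v) ->
  reduced (invw (a :: u) ++ b :: v).
Proof.
move=> ab ru rv; have invE : invw (a :: u) = invw u ++ [:: letter_inv a].
  by rewrite /invw /= rev_cons cats1.
rewrite invE -catA; apply: reduced_cat3 => //;
  first by rewrite -invE reduced_invw.
by apply/andP; rewrite letter_invK eq_sym ab.
Qed.

Lemma letter_inv_neq a : a != letter_inv a.
Proof. by case: a => i []; rewrite /letter_inv xpair_eqE /= andbF. Qed.

Lemma reduced_nseql a n u : reduced (a :: u) -> reduced (nseq n.+1 a ++ u).
Proof.
move=> rau; elim: n => // n IHn; apply/andP; split=> //; exact: letter_inv_neq.
Qed.

Lemma reduced_nseq a n : reduced (nseq n a).
Proof. by case: n => // n; rewrite -[nseq _ _]cats0; exact: reduced_nseql. Qed.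

Lemma reduced_nseqr a n u : reduced (u ++ [:: a]) -> reduced (u ++ nseq n a).
Proof.
case: n => [|n] rua; first by rewrite cats0; exact: reduced_catl rua.
by rewrite -[nseq _ _]/([:: a] ++ _); apply: reduced_cat3 => //;
  exact: (reduced_nseq a n.+1).
Qed.

Lemma nseq_split n0 n a : (n0 <= n)%N -> nseq n a = nseq (n - n0) a ++
  nseq n0 a.
Proof. by move=> h; rewrite -nseqD subnK. Qed.

Lemma reduced_nseq2 a b m n : b != letter_inv a ->
  reduced (nseq m a ++ nseq n b).
Proof.
move=> ba; case: m => [|m]; first exact: reduced_nseq.
apply: reduced_nseql; case: n => // n; apply/andP; split=> //;
  exact: (reduced_nseq b n.+1).
Qed.

Lemma invw_nseq n a : invw (nseq n a) = nseq n (letter_inv a).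
Proof. by rewrite /invw map_nseq rev_nseq. Qed.

Lemma fresh_letter (s : word) : (2 <= N)%N -> (size s < 4)%N ->
  exists z : letter N, z \notin s.
Proof.
move=> N2 s4; apply: contrapT => no; suff : (N * 2 <= size s)%N by lia.
have {1}<- : #|{: 'I_N * bool}| = (N * 2)%N by rewrite card_prod card_ord
  card_bool.
apply: leq_trans (card_size s); apply: subset_leq_card; apply/fintype.subsetP =>
  z _.
by apply: contrapT => /negP zs; apply: no; exists z.
Qed.

Lemma reduced_rcons u a :
  reduced u -> a != letter_inv (last a u) -> reduced (u ++ [:: a]).
Proof.
case: u => //= b u ru; rewrite /reduced /= => ub.
by rewrite cats1 rcons_path; apply/andP; split.
Qed.

Lemma fgw_exp w n : fgw (flatten (nseq n w)) = (fgw w ^+ n)%g.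
Proof. by elim: n => [|n IHn]; rewrite ?fgw0 //= fgw_cat IHn expgS. Qed.

(** [reduced (w ++ w)] says that [w] is cyclically reduced. *)
Lemma reduced_exp w n : reduced (w ++ w) ->
  reduced (w ++ flatten (nseq n w)).
Proof.
move=> rw; have [->|w0] := eqVneq w [::]; first by elim: n.
elim: n => [|n IHn] /=; first by rewrite cats0; exact: reduced_catl rw.
exact: reduced_cat3.
Qed.

Lemma cyclically_reduced a (c : letter N) w : reduced w -> a != letter_inv c ->
  head a w = a -> last c w = c -> w != [::] -> reduced (w ++ w).
Proof.
case: w => // b w rw ac ba lw _; rewrite /= in ba lw; rewrite {}ba in rw lw *.
have wE : a :: w = belast a w ++ [:: c] by rewrite cats1 -lw -lastI.
have -> : (a :: w) ++ (a :: w) = belast a w ++ [:: c] ++ a :: w.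
  by rewrite {1}wE -catA.
apply: reduced_cat3 => //; first by rewrite -wE.
by apply/andP.
Qed.

(** Cancellation in [b^-n h a^n] eats at most [fgsize h] letters on either
    side, as the powers of [b] and of [a] have no common prefix. *)
Lemma fgw_flanked a b h n0 n : a != b -> (n0 + fgsize h < n)%N ->
  exists v, reduced (invw (nseq n0 b) ++ v ++ nseq n0 a) /\
    ((fgw (nseq n b))^-1 * h * fgw (nseq n a))%g =
      fgw (invw (nseq n0 b) ++ v ++ nseq n0 a).
Proof.
move=> ab hn.
have [c1 [u1 [v1 [hE bE r1]]]] := common_prefix h (fgw (nseq n b)).
rewrite val_fgw ?reduced_nseq // in bE.
pose X := (h^-1 * fgw (nseq n b))%g; pose k := size v1.
have sz1 : (size c1 + k = n)%N by rewrite -size_cat -bE size_nseq.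
have c1h : (size c1 + size u1 = fgsize h)%N by rewrite -size_cat -hE.
have v1E : v1 = nseq k b.
  apply/all_pred1P/allP => z zv; have : z \in nseq n b by rewrite bE mem_cat zv
    orbT.
  by rewrite mem_nseq => /andP[].
have XE : val X = invw u1 ++ nseq k b.
  by rewrite /X -(fgw_val h) hE bE fgVM_common val_fgw // v1E.
have [c [u [v [XE' aE r]]]] := common_prefix X (fgw (nseq n a)).
rewrite val_fgw ?reduced_nseq // in aE.
have sz : (size c + size v = n)%N by rewrite -size_cat -aE size_nseq.
have allc : all (pred1 a) c.
  apply/allP => z zc; have : z \in nseq n a by rewrite aE mem_cat zc.
  by rewrite mem_nseq => /andP[].
have vE : v = nseq (size v) a.
  apply/all_pred1P/allP => z zv; have : z \in nseq n a by rewrite aE mem_cat zv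
    orbT.
  by rewrite mem_nseq => /andP[].
have cu1 : (size c <= size u1)%N.
  rewrite leqNgt; apply/negP => lt; have k0 : (0 < k)%N by lia.
  have : nth a (val X) (size u1) = b.
    by rewrite XE nth_cat size_invw ltnn subnn nth_nseq k0.
  rewrite XE' nth_cat lt => cb; have := allP allc _ (mem_nth a lt).
  by rewrite cb /= eq_sym (negbTE ab).
have uE : u = drop (size c) (invw u1) ++ nseq k b.
  have := congr1 (drop (size c)) XE'.
  rewrite drop_size_cat // => <-; rewrite XE drop_cat size_invw.
  case: ltnP => // u1c; have -> : size c = size u1 by lia.
  by rewrite subnn drop0 drop_oversize ?size_invw.
exists (invw (drop (size c) (invw u1) ++ nseq (k - n0) b) ++ nseq (size v - n0)
  a).
have e : invw u ++ v = invw (nseq n0 b) ++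
    (invw (drop (size c) (invw u1) ++ nseq (k - n0) b) ++ nseq (size v - n0) a)
      ++
    nseq n0 a.
  rewrite vE size_nseq uE (@nseq_split n0 k) ?(@nseq_split n0 (size v) a);
    [|lia|lia].
  by rewrite !invw_cat -!catA.
split; first by rewrite -e.
rewrite -e -(fgVM_common c) -XE' -aE fgw_val /X invgM invgK.
by [].
Qed.

End Words.

(** * Subadditive sequences *)

Section Subadditive.
Variable R : realType.

(** Fekete's lemma. *)
Lemma subadditive_cvg (u : nat -> R) : (forall n, 0 <= u n) -> u 0%N = 0 ->
  (forall m n, u (m + n)%N <= u m + u n) ->
  cvgn (fun n => u n / n%:R).
Proof.
move=> u0 u00 uD; pose E := [set u n.+1 / n.+1%:R | n in [set: nat]].
have E0 : E !=set0 by exists (u 1%N / 1%:R); exists 0%N.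
have lbE : lbound E 0 by move=> _ [n _ <-]; rewrite divr_ge0.
have hE : has_inf E by split=> //; exists 0.
apply/cvg_ex; exists (inf E); apply/cvgrPdist_le => e e0.
have e20 : 0 < e / 2 by rewrite divr_gt0.
have [_ [m _ <-] mE] := inf_adherent e20 hE.
have uM q k : u (q * k)%N <= q%:R * u k.
  elim: q => [|q IHq]; last first.
    by rewrite mulSn (le_trans (uD _ _)) // -[q.+1]add1n natrD mulrDl mul1r
      lerD.
  by rewrite mul0n mul0r u00.
have uB r : u r <= r%:R * u 1%N by have := uM r 1%N; rewrite muln1.
have [n0 n0P] : exists n0 : nat, (m.+1%:R * u 1%N) / (e / 2) < n0%:R.
  by exists (Num.truncn ((m.+1%:R * u 1%N) / (e / 2))).+1; rewrite truncnS_gt.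
exists n0.+1 => // n /= nn0; have n1 : (0 < n)%N by exact: leq_trans nn0.
have nR : 0 < n%:R :> R by rewrite ltr0n.
have lE : inf E <= u n / n%:R.
  by apply: ge_inf; [exists 0 | exists n.-1; rewrite ?prednK].
rewrite ler0_norm ?subr_le0 // opprB lerBlDr.
suff : u n / n%:R <= u m.+1 / m.+1%:R + m.+1%:R * u 1%N / n%:R.
  move=> /le_trans; apply.
  have : m.+1%:R * u 1%N / n%:R <= e / 2.
    by rewrite ler_pdivrMr // [leRHS]mulrC -ler_pdivrMr // (le_trans (ltW n0P))
      // ler_nat ltnW.
  by move: mE; move: (u m.+1 / _) (_ / n%:R) (inf E) => A B I; lra.
rewrite ler_pdivrMr // mulrDl [X in _ + X]divfK ?gt_eqF //.
rewrite {1}(divn_eq n m.+1) (le_trans (uD _ _)) // lerD //.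
  rewrite (le_trans (uM _ _)) // mulrAC ler_pdivlMr ?ltr0n // mulrAC mulrC.
  by rewrite ler_wpM2l // -natrM ler_nat leq_divM.
by rewrite (le_trans (uB _)) // ler_wpM2r // ler_nat ltnW // ltn_mod.
Qed.

Lemma le_limn_near (a : nat -> R) (c D : R) : cvgn a ->
  (forall n, (0 < n)%N -> c - D / n%:R <= a n) -> c <= limn a.
Proof.
move=> ca aP; apply/ler_addgt0Pr => e e0; rewrite -lerBlDr; apply: limr_ge =>
  //.
exists (Num.truncn (`|D| / e)).+1 => // n /= nn0.
have n0 : (0 < n)%N by exact: leq_trans nn0.
apply: le_trans (aP n n0); rewrite lerD2l lerN2 ler_pdivrMr ?ltr0n //
  [leRHS]mulrC.
rewrite -ler_pdivrMr // (@le_trans _ _ (`|D| / e)) ?ler_wpM2r ?ler_norm //.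
  by rewrite invr_ge0 ltW.
by rewrite (le_trans (ltW (truncnS_gt _))) // ler_nat.
Qed.

End Subadditive.

(** * Word metrics and stable length *)

Lemma repr_conj_class (G : groupType) (x : G) :
  exists g, repr (conj_class x) = (x ^ g)%g.
Proof.
have : conjugate x (repr (conj_class x)) by apply/eqmodP; rewrite reprK.
by move=> /asboolP.
Qed.

Section WordMetricFreeGroup.
Variables (N : nat) (S : {fset free_group N}).
Hypothesis genS : generates S.
Local Notation F := (free_group N).
Implicit Types (x y g : F) (u v w : seq (letter N)).
Local Notation wl := (word_length S).

Lemma word_length1 : wl 1%g = 0%N.
Proof.
by apply/eqP; rewrite -leqn0 -[X in (_ <= X)%N](_ : size (Nil F) = _) //
  word_length_le // big_nil.
Qed.

Lemma word_lengthV x : wl x^-1%g = wl x.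
Proof.
suff H y : (wl y^-1%g <= wl y)%N.
  by apply/eqP; rewrite eqn_leq H -{1}[x]invgK H.
have /asboolP[w [<- ww <-]] := word_lengthP genS y.
rewrite -[leqRHS](size_map (fun s : F => s^-1%g)) -size_rev.
apply: word_length_le.
  rewrite /is_word all_rev all_map; apply: sub_all ww => s /=.
  by rewrite invgK orbC.
elim: w {ww} => [|s w IHw]; first by rewrite !big_nil invg1.
by rewrite /= rev_cons -cats1 big_cat big_seq1 IHw big_cons invgM.
Qed.

Lemma word_length_fgsize : exists M, forall x, (wl x <= M * fgsize x)%N.
Proof.
exists (\max_(a : 'I_N * bool) wl (fgw [:: a])) => x.
rewrite -{1}(fgw_val x) /fgsize; elim: (val x) => [|a w IHw].
  by rewrite fgw0 word_length1.
rewrite -cat1s fgw_cat (leq_trans (word_lengthM genS _ _)) // mulnS leq_add //.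
exact: (leq_bigmax (F := fun a => wl (fgw [:: a]))).
Qed.

Definition max_gen_size : nat := \max_(s <- enum_fset S) fgsize s.

Lemma max_gen_sizeP s : (s \in S) || (s^-1%g \in S) ->
  (fgsize s <= max_gen_size)%N.
Proof.
rewrite /max_gen_size; move=> /orP[sS|sS].
  exact: (leq_bigmax_seq (F := @fgsize N)).
by rewrite -fgsizeV; exact: (leq_bigmax_seq (F := @fgsize N)).
Qed.

Lemma fgsize_word_length x : (fgsize x <= max_gen_size * wl x)%N.
Proof.
have /asboolP[w [<- ww <-]] := word_lengthP genS x.
elim: w ww => [|s w IHw]; first by rewrite big_nil.
rewrite /is_word /= => /andP[/max_gen_sizeP ss /IHw {}IHw].
by rewrite big_cons (leq_trans (fgsizeM _ _)) // mulnS leq_add.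
Qed.

(** A [d_S]-geodesic from 1 to [u v] is a chain with bounded jumps in the tree
    of reduced words, so it passes near [u]. *)
Lemma word_length_cat : exists K, forall u v, reduced (u ++ v) ->
  (wl (fgw u) + wl (fgw v) <= wl (fgw (u ++ v)) + K)%N.
Proof.
have [M MP] := word_length_fgsize.
exists (M * max_gen_size).*2 => u v ruv.
have /asboolP[w [wE ww wP]] := word_lengthP genS (fgw (u ++ v)).
pose s i := (\prod_(z <- take i w) z)%g.
have is_take i : is_word S (take i w) by apply/allP => z /mem_take;
  exact: (allP ww).
have is_drop i : is_word S (drop i w) by apply/allP => z /mem_drop;
  exact: (allP ww).
have sE i : (s i * \prod_(z <- drop i w) z)%g = fgw (u ++ v).
  by rewrite /s -big_cat cat_take_drop.
have [|||i ik iP] := @chain_near_prefix N s (size w) max_gen_size u v ruv.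
- by rewrite /s take0 big_nil.
- by rewrite /s take_size.
- move=> i iw; rewrite /s (take_nth 1%g) // -cats1 big_cat big_seq1 mulKg.
  exact/max_gen_sizeP/(allP ww)/mem_nth.
have h1 : (wl (s i) <= i)%N.
  rewrite (leq_trans (word_length_le (is_take i) erefl)) //.
  by rewrite size_take; case: ifP => // /negbT; rewrite -leqNgt.
have h2 : (wl ((s i)^-1 * fgw (u ++ v))%g <= size w - i)%N.
  by rewrite -size_drop -(sE i) mulKg; exact: word_length_le.
have h3 : (wl ((s i)^-1 * fgw u)%g <= M * max_gen_size)%N.
  by rewrite (leq_trans (MP _)) // leq_mul2l iP orbT.
have h4 : (wl (fgw u) <= wl (s i) + wl ((s i)^-1 * fgw u)%g)%N.
  by rewrite -[in X in (X <= _)%N](mulVKg (s i) (fgw u)) word_lengthM.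
have h5 : (wl (fgw v) <=
    wl ((s i)^-1 * fgw u)%g + wl ((s i)^-1 * fgw (u ++ v))%g)%N.
  rewrite -(word_lengthV ((s i)^-1 * _)%g).
  rewrite (leq_trans _ (word_lengthM genS _ _)) //.
  by rewrite invgM invgK -mulgA mulVKg fgw_cat mulKg.
rewrite -wE -addnn; move: (_ * _)%N ik h1 h2 h3 h4 h5 => E; lia.
Qed.

End WordMetricFreeGroup.

Section StableLength.
Variables (R : realType) (N : nat) (S : {fset free_group N}).
Hypothesis genS : generates S.
Implicit Types (x y g : free_group N) (w : seq (letter N)).
Local Notation wl := (word_length S).

Lemma word_dist1 x : word_dist S 1%g x = wl x.
Proof. by rewrite /word_dist invg1 mul1g. Qed.

Lemma stable_length_ge (K : nat) w :
    (forall u v, reduced (u ++ v) ->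
      (wl (fgw u) + wl (fgw v) <= wl (fgw (u ++ v)) + K)%N) ->
    reduced (w ++ w) ->
  (wl (fgw w))%:R - K%:R <= stable_length R S (conj_class (fgw w)).
Proof.
move=> KP rw; have [g gE] := repr_conj_class (fgw w).
rewrite /stable_length gE.
have e_cvg : cvgn (fun n => (word_dist S 1%g ((fgw w ^ g) ^+ n)%g)%:R / n%:R :
  R).
  apply: subadditive_cvg => //; first by rewrite expg0 word_dist1 word_length1.
  by move=> m n; rewrite expgnDr !word_dist1 -natrD ler_nat word_lengthM.
apply: (le_limn_near (D := (wl g)%:R + (wl g)%:R) e_cvg) => n n0.
have nR : 0 < n%:R :> R by rewrite ltr0n.
rewrite ler_pdivlMr // mulrBl divfK ?gt_eqF // lerBlDr -!natrD mulrBl lerBlDr.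
rewrite -!natrM -!natrD ler_nat word_dist1.
have h1 : (wl (fgw w ^+ n)%g <= wl ((fgw w ^ g) ^+ n)%g + (wl g + wl g))%N.
  rewrite -conjXg /conjg.
  move: (fgw w ^+ n)%g => y.
  have {1}-> : y = (g * ((g^-1 * (y * g)) * g^-1))%g.
    by rewrite !mulgA mulgV mul1g mulgK.
  have := word_lengthM genS g ((g^-1 * (y * g)) * g^-1)%g.
  have := word_lengthM genS (g^-1 * (y * g))%g g^-1%g.
  rewrite word_lengthV // => h1 h2; apply: leq_trans h2 _.
  by rewrite addnCA leq_add2l.
suff h2 : (wl (fgw w) * n <= wl (fgw w ^+ n)%g + K * n)%N by lia.
rewrite -fgw_exp; elim: n {n0 nR h1} => [|n IHn]; first by rewrite muln0.
rewrite !mulnS /=; have := KP w _ (reduced_exp n rw); lia.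
Qed.

End StableLength.

(** * Real trees *)

Section RealTrees.
Variables (R : realType) (T : metricType R).
Implicit Types (x y z w p q : T).
Local Notation d := (@mdist R T).

(** In a geodesic space the points [p] with [btw x p y] make up the union of
    the segments from [x] to [y]. *)
Definition btw x p y : Prop := d x p + d p y = d x y.

Lemma lipschitz_within (A : set R) (f : R -> T) (L : R) : 0 <= L ->
  (forall s t, A s -> A t -> s <= t -> d (f s) (f t) <= L * (t - s)) ->
  {within A, continuous f}.
Proof.
move=> L0 fL; apply/subspace_continuousP => x Ax.
have fL' s t : A s -> A t -> d (f s) (f t) <= L * `|s - t|.
  move=> As At; have [st|/ltW ts] := leP s t;
    first by rewrite ler0_norm ?subr_le0 // opprB fL.
  by rewrite ger0_norm ?subr_ge0 // metric_sym fL.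
apply/metricType_numDomainType.cvgrPdist_lt => e e0.
have L1 : 0 < L + 1 by rewrite ltr_pwDr.
rewrite near_withinE; near=> t => At.
apply: le_lt_trans (fL' _ _ Ax At) _.
have : `|x - t| < e / (L + 1).
  by near: t; apply: cvgr_dist_lt; [exact: cvg_id|rewrite divr_gt0].
rewrite ltr_pdivlMr // mulrC; apply: le_lt_trans.
by rewrite ler_wpM2r // lerDl.
Unshelve. all: by end_near. Qed.

Lemma btwC x p y : btw x p y -> btw y p x.
Proof. by rewrite /btw addrC (metric_sym y p) (metric_sym p x) (metric_sym y x).
  Qed.

Hypothesis treeT : is_real_tree T.

(** Two segments which meet only at their common end [w] make up an arc, and
    in a real tree arcs are segments. *)
Lemma tree_arc x y : exists gamma : R -> T,
  [/\ gamma 0 = x, gamma (d x y) = y,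
      {in `[0, d x y] &, forall s t, d (gamma s) (gamma t) = `|s - t|} &
      forall w, (forall q, btw x q w -> btw w q y -> q = w) ->
        exists2 t, t \in `[0, d x y] & gamma t = w].
Proof.
have [_ tr] := treeT; have [g [g0 g1 giso garc]] := tr x y.
exists g; split=> // w wP.
have [h [h0 h1 hiso _]] := tr x w; have [k [k0 k1 kiso _]] := tr w y.
pose a := d x w; pose b := d w y; pose L := a + b.
have a0 : 0 <= a by exact: mdist_ge0.
have b0 : 0 <= b by exact: mdist_ge0.
have hin (s : R) : 0 <= s -> s <= a -> s \in `[0, a] by move=> ? ?;
  rewrite in_itv /=; apply/andP.
have kin (s : R) : 0 <= s -> s <= b -> s \in `[0, b] by move=> ? ?;
  rewrite in_itv /=; apply/andP.
have gin (s : R) : 0 <= s -> s <= d x y -> s \in `[0, d x y].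
  by move=> ? ?; rewrite in_itv /=; apply/andP.
have [L0|L0] := eqVneq L 0.
  exists 0; first by rewrite gin ?mdist_ge0.
  by rewrite g0; apply: mdist_positivity; rewrite -/a; move: L0; rewrite /L;
    lra.
have {}L0 : 0 < L by rewrite lt_neqAle eq_sym L0 addr_ge0.
have hd (s t : R) : 0 <= s -> s <= t -> t <= a -> d (h s) (h t) = t - s.
  move=> s0 st ta; rewrite hiso; last 2 first.
  - by apply: hin => //; exact: le_trans ta.
  - by apply: hin => //; exact: le_trans st.
  by rewrite ler0_norm ?subr_le0 // opprB.
have kd (s t : R) : 0 <= s -> s <= t -> t <= b -> d (k s) (k t) = t - s.
  move=> s0 st tb; rewrite kiso; last 2 first.
  - by apply: kin => //; exact: le_trans tb.
  - by apply: kin => //; exact: le_trans st.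
  by rewrite ler0_norm ?subr_le0 // opprB.
(* The two segments end to end, parametrized by length: a Lipschitz and
   injective curve, which becomes an arc on the unit interval after
   rescaling. *)
pose k' (s : R) := if s <= a then h s else k (s - a).
have cm (s t : R) : 0 <= s -> s <= a -> a <= t -> t <= L ->
    [/\ d x (h s) = s, d (h s) w = a - s, d w (k (t - a)) = t - a &
    d (k (t - a)) y = L - t].
  move=> s0 sa ta tL; have tb : t - a <= b by move: tL; rewrite /L; lra.
  have ta0 : 0 <= t - a by rewrite subr_ge0.
  split.
  - by rewrite -[X in d X _]h0 hd ?subr0.
  - by rewrite -[X in d _ X]h1 hd.
  - by rewrite -[X in d X _]k0 kd ?subr0.
  - by rewrite -[X in d _ X]k1 kd // /L -/b; lra.
have clip (s t : R) : 0 <= s -> s <= t -> t <= L -> d (k' s) (k' t) <= t - s.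
  move=> s0 st tL; rewrite /k'; case: ifPn => sa; case: ifPn => ta.
  - by rewrite hd.
  - rewrite -ltNge in ta; have [_ e1 e2 _] := cm s t s0 sa (ltW ta) tL.
    by have := metric_triangle (h s) w (k (t - a)); lra.
  - by move: sa; rewrite -ltNge; lra.
  - by rewrite -!ltNge in sa ta; rewrite kd; move: tL; rewrite /L; lra.
have cinj (s t : R) : 0 <= s -> t <= L -> s < t -> k' s != k' t.
  move=> s0 tL st; apply/eqP; rewrite /k'; case: ifPn => sa; case: ifPn => ta.
  - by move=> e; have := hd s t s0 (ltW st) ta; rewrite e mdistxx; lra.
  - rewrite -ltNge in ta; have [e1 e2 e3 e4] := cm s t s0 sa (ltW ta) tL.
    move=> e; have hw : h s = w.
      apply: wP; first by rewrite /btw e1 e2 -/a; lra.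
      by rewrite /btw e e3 e4 -/b /L; lra.
    by move: e3; rewrite -e hw mdistxx; lra.
  - by move=> _; move: sa; rewrite -ltNge; lra.
  - rewrite -!ltNge in sa ta; move=> e; have tb : t - a <= b by move: tL;
    rewrite /L; lra.
    by have := kd (s - a) (t - a); rewrite e mdistxx; lra.
pose c (t : R) := k' (t * L).
have c0 : c 0 = x by rewrite /c /k' mul0r a0.
have c1 : c 1 = y.
  rewrite /c /k' mul1r /L; case: ifPn => [ba|_].
    have b00 : b = 0 by lra.
    by rewrite b00 addr0 -/a h1; apply: mdist_positivity.
  by rewrite [a + b]addrC addrK.
have ccont : {within `[0, 1], continuous c}.
  apply: (lipschitz_within (ltW L0)) => s t; rewrite /= !in_itv /=.
  move=> /andP[s0 _] /andP[_ t1] st; rewrite mulrC mulrBl clip //.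
  - by rewrite mulr_ge0 // ltW.
  - by rewrite ler_pM2r.
  - by rewrite ler_piMl // ltW.
have {}cinj : {in `[0, 1] &, injective c}.
  have H (s t : R) : 0 <= s -> t <= 1 -> s < t -> c s != c t.
    move=> s0 t1 st; apply: cinj; first by rewrite mulr_ge0 // ltW.
      by rewrite ler_piMl // ltW.
    by rewrite ltr_pM2r.
  move=> s t; rewrite !in_itv /= => /andP[s0 s1] /andP[t0 t1] cst.
  have [st|ts|//] := ltgtP s t; first by move: (H s t s0 t1 st);
    rewrite cst eqxx.
  by move: (H t s t0 s1 ts); rewrite cst eqxx.
have /seteqP[cg _] := garc c ccont cinj c0 c1.
have [|t tin gt] := cg w; last by exists t.
exists (a / L).
  by rewrite /= in_itv /= divr_ge0 ?(ltW L0) // ler_pdivrMr // mul1r /L lerDl.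
by rewrite /c /k' divfK ?gt_eqF // lexx.
Qed.

Lemma btw_eq x p q y : btw x p y -> btw x q p -> btw p q y -> q = p.
Proof.
rewrite /btw => xpy xqp pqy; apply: mdist_positivity.
by have := metric_triangle x q y; have := mdist_ge0 q p;
  rewrite (metric_sym p q) in pqy; lra.
Qed.

(** Each [p] with [btw x p y] splits off two segments meeting only at [p], so
    it is on the one arc from [x] to [y]. *)
Lemma btw_param x y : exists gamma : R -> T,
  [/\ forall t, 0 <= t -> t <= d x y -> d x (gamma t) = t /\ btw x (gamma t) y,
      forall s t, 0 <= s -> s <= t -> t <= d x y -> d (gamma s) (gamma t) =
        t - s &
      forall p, btw x p y -> gamma (d x p) = p].
Proof.
have [g [g0 g1 giso garc]] := tree_arc x y.
have gd (s t : R) : 0 <= s -> s <= t -> t <= d x y -> d (g s) (g t) = t - s.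
  move=> s0 st tb; rewrite giso ?ler0_norm ?subr_le0 // ?opprB // in_itv /= ?s0
    ?tb ?andbT.
    exact: le_trans tb.
  exact: le_trans st.
exists g; split=> // [t t0 t1|p xpy].
  have e1 : d x (g t) = t by rewrite -{1}g0 gd ?subr0.
  have e2 : d (g t) y = d x y - t by rewrite -{1}g1 gd.
  by rewrite /btw e1 e2 subrKC.
have [q|t] := garc p; first exact: (btw_eq xpy).
rewrite in_itv /= => /andP[t0 t1] <-; congr g.
by rewrite -[X in d X _]g0 gd ?subr0.
Qed.

Lemma btw_arc x w y : (forall q, btw x q w -> btw w q y -> q = w) -> btw x w y.
Proof.
move=> wP; have [g [g0 g1 giso garc]] := tree_arc x y.
have [t tin <-] := garc w wP; move: (tin); rewrite in_itv /= => /andP[t0 t1].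
have i0 : 0 \in `[0, d x y] by rewrite in_itv /= lexx mdist_ge0.
have i1 : d x y \in `[0, d x y] by rewrite in_itv /= lexx mdist_ge0.
have e1 : d x (g t) = t by rewrite -{1}g0 giso // sub0r normrN ger0_norm.
have e2 : d (g t) y = d x y - t by rewrite -{1}g1 giso // ler0_norm ?subr_le0 //
  opprB.
by rewrite /btw e1 e2 subrKC.
Qed.

Lemma btw_le x p q y : btw x p y -> btw x q y -> d x p <= d x q -> btw x p q.
Proof.
move=> xpy xqy pq; have [g [_ gd gP]] := btw_param x y.
have qy : d x q <= d x y by move: xqy; rewrite /btw; have := mdist_ge0 q y; lra.
have : d p q = d x q - d x p by rewrite -{1}(gP p xpy) -{1}(gP q xqy) gd
  ?mdist_ge0.
by rewrite /btw; lra.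
Qed.

Lemma btw_trans x p q y : btw x q y -> btw x p q -> btw x p y.
Proof.
rewrite /btw => e1 e2; have := metric_triangle p q y; have :=
  metric_triangle x p y; lra.
Qed.

(** The branch point: the last point of the segment from [x] to [y] which is
    also on the segment from [x] to [z]. *)
Lemma tree_median x y z : exists w, [/\ btw x w y, btw x w z & btw y w z].
Proof.
have [g [gP gd gI]] := btw_param x y.
pose A := [set t | [/\ 0 <= t, t <= d x y & btw x (g t) z]].
have A0 : A 0.
  split; rewrite ?mdist_ge0 //; have [/mdist_positivity <- _] :=
    gP 0 (lexx _) (mdist_ge0 _ _).
  by rewrite /btw mdistxx add0r.
have hA : has_sup A by split; [exists 0 | exists (d x y) => t []].
pose t0 := sup A; have t00 : 0 <= t0 by apply: ub_le_sup => //; case: hA.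
have t01 : t0 <= d x y by apply: ge_sup; [exists 0 | move=> t []].
have [dw xwy] := gP t0 t00 t01; pose w := g t0; rewrite -/w in dw xwy.
have xwz : btw x w z.
  apply/eqP; rewrite eq_le metric_triangle andbT; apply/ler_addgt0Pr => e e0.
  have e2 : 0 < e / 2 by rewrite divr_gt0.
  have [t [t1 t2 tz] lt] := sup_adherent e2 hA.
  have tt : t <= t0 by apply: ub_le_sup => //; case: hA.
  have := gd t t0 t1 tt t01; rewrite -/w.
  have := metric_triangle x (g t) w; have := metric_triangle w (g t) z.
  by rewrite (metric_sym w (g t)); move: tz; rewrite /btw; rewrite -/t0 in lt;
    lra.
exists w; split=> //; apply: btw_arc => q qy qz.
have xqz : btw x q z.
  by apply: btwC; apply: btw_trans (btwC xwz) (btwC qz).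
have xqy : btw x q y by apply: btwC; apply: btw_trans (btwC xwy) qy.
have : d x q <= t0.
  apply: ub_le_sup; first by case: hA.
  split; rewrite ?mdist_ge0 ?gI //; move: xqy; rewrite /btw; have :=
    mdist_ge0 q y; lra.
rewrite -dw => qw; apply: mdist_positivity; have := btw_le xqy xwy qw.
move: qy xqy xwy; rewrite /btw (metric_sym y q) (metric_sym y w); have :=
  mdist_ge0 q w; lra.
Qed.

(** The segment from [x] to [y] is covered by the other two sides of the
    triangle, on either side of the branch point. *)
Lemma btw_split x p y z : btw x p y -> btw x p z \/ btw z p y.
Proof.
move=> xpy; have [w [xwy xwz ywz]] := tree_median x y z.
have [pw|/ltW wp] := leP (d x p) (d x w).
  by left; apply: btw_trans xwz _; exact: btw_le xwy pw.
right; have xwp := btw_le xwy xpy wp.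
have := metric_triangle z p y; have := metric_triangle z w p.
move: xpy xwy ywz xwp; rewrite /btw.
rewrite (metric_sym y w) (metric_sym w z) (metric_sym y z); lra.
Qed.

(** Gromov's condition for zero hyperbolicity. *)
Lemma tree_4point x y z w :
  d x y + d z w <= d x z + d y w \/ d x y + d z w <= d x w + d y z.
Proof.
have [p [xpy xpz ypz]] := tree_median x y z.
have := metric_triangle z p w.
have [|] := btw_split w xpy; move: xpy xpz ypz; rewrite /btw.
  by rewrite (metric_sym z p) => e1 e2 e3 e4; right; move: e1 e2 e3 e4;
     rewrite (metric_sym p y); lra.
rewrite (metric_sym z p) (metric_sym w p) (metric_sym y w) (metric_sym w y).
by rewrite (metric_sym p y) => e1 e2 e3 e4; left; lra.
Qed.

Lemma segment_image x y : exists2 gamma : R -> T,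
  {within `[0, d x y], continuous gamma} &
  [set p | btw x p y] = gamma @` `[0, d x y].
Proof.
have [g [gP gd gI]] := btw_param x y; exists g.
  apply: (@lipschitz_within _ _ 1) => // s t.
  by rewrite /= !in_itv /= => /andP[? ?] /andP[? ?] st; rewrite mul1r gd.
apply/seteqP; split=> [p xpy|p [t]].
  exists (d x p); last exact: gI.
  rewrite /= in_itv /= mdist_ge0 /=; move: xpy; rewrite /= /btw.
  by have := mdist_ge0 p y; lra.
by rewrite /= in_itv /= => /andP[t0 t1] <-; case: (gP t t0 t1).
Qed.

Lemma tree_segment_connected x y : connected [set p | btw x p y].
Proof.
have [g gc ->] := segment_image x y.
by apply: connected_continuous_connected => //; exact: segment_connected.
Qed.

Lemma tree_segment_compact x y : compact [set p | btw x p y].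
Proof.
have [g gc ->] := segment_image x y.
by apply: continuous_compact => //; exact: segment_compact.
Qed.

End RealTrees.

(** * Displacement functions of free discrete actions *)

Section OuterTrees.
Variables (R : realType) (N : nat) (N_ge2 : (2 <= N)%N) (T : outer_tree R N)
  (o : T).
Local Notation F := (free_group N).
Local Notation d := (@mdist R T).
Implicit Types (g h : F) (p q x y : T) (u v w : seq (letter N)).

Let treeT : is_real_tree T := ot_real_tree T.

Lemma ot_actK g p : ot_act g^-1%g (ot_act g p) = p.
Proof. by rewrite -ot_actM mulVg ot_act1. Qed.

Lemma ot_actKV g p : ot_act g (ot_act g^-1%g p) = p.
Proof. by rewrite -ot_actM mulgV ot_act1. Qed.

Lemma btw_act g x p y : btw (ot_act g x) (ot_act g p) (ot_act g y) <->
  btw x p y.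
Proof. by rewrite /btw !ot_isometric. Qed.

Definition displ g : R := d o (ot_act g o).

Lemma displ_ge0 g : 0 <= displ g. Proof. exact: mdist_ge0. Qed.

Lemma displ1 : displ 1%g = 0. Proof. by rewrite /displ ot_act1 mdistxx. Qed.

Lemma mdist_orbit g h : d (ot_act g o) (ot_act h o) = displ (g^-1 * h)%g.
Proof. by rewrite -(@ot_isometric _ _ _ g^-1%g) ot_actK -ot_actM. Qed.

Lemma displV g : displ g^-1%g = displ g.
Proof. by rewrite /displ -(@ot_isometric _ _ _ g) ot_actKV metric_sym. Qed.

Lemma displM g h : displ (g * h)%g <= displ g + displ h.
Proof.
apply: le_trans (metric_triangle _ (ot_act g o) _) _.
by rewrite -/(displ g) mdist_orbit mulKg.
Qed.

Definition displ_letter : R := \sum_(a : 'I_N * bool) displ (fgw [:: a]).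

Lemma displ_letter_ge0 : 0 <= displ_letter.
Proof. by apply: sumr_ge0 => a _; exact: displ_ge0. Qed.

Lemma displ_letterP (a : letter N) : displ (fgw [:: a]) <= displ_letter.
Proof.
rewrite /displ_letter (bigD1 (a : 'I_N * bool)) //= lerDl.
by apply: sumr_ge0 => b _; exact: displ_ge0.
Qed.

Lemma displ_fgsize g : displ g <= displ_letter * (fgsize g)%:R.
Proof.
rewrite -{1}(fgw_val g) /fgsize; elim: (val g) => [|a w IHw].
  by rewrite fgw0 displ1 mulr0.
rewrite -cat1s fgw_cat (le_trans (displM _ _)) //= -[(size w).+1]add1n natrD.
by rewrite mulrDr mulr1 lerD // displ_letterP.
Qed.

(** By minimality, since the union of the segments from [x] to the points of
    its orbit is connected and invariant. *)
Lemma orbit_hull x p : exists g, btw x p (ot_act g x).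
Proof.
pose A := \bigcup_(g in [set: F]) [set p | btw x p (ot_act g x)].
suff AT : A = setT by have : A p by [rewrite AT]; move=> [g _ gp]; exists g.
have btwxx y : btw x x y by rewrite /btw mdistxx add0r.
apply: ot_minimal.
- by exists x; exists 1%g => //; exact: btwxx.
- apply: bigcup_connected; first by exists x => g _; exact: btwxx.
  by move=> g _; exact: tree_segment_connected treeT _ _.
- move=> g q [h _ /= hq].
  have : btw (ot_act g x) (ot_act g q) (ot_act (g * h)%g x).
    by rewrite ot_actM; apply/btw_act.
  by case/(btw_split treeT x) => [/btwC gq|gq]; [exists g|exists (g * h)%g].
Qed.

(** The segments from [o] to its translates by the letters make up a compact
    set whose translates cover the tree; [g] carries the points of its
    translate. *)
Definition carries g p : Prop :=
  exists a : letter N, btw (ot_act g o) p (ot_act (g * fgw [:: a])%g o).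

Lemma carriesM g h p : carries h p -> carries (g * h)%g (ot_act g p).
Proof. by move=> [a ap]; exists a; rewrite -!mulgA !(ot_actM g);
  apply/btw_act. Qed.

Lemma carries_self g : carries g (ot_act g o).
Proof. by exists (Ordinal (ltnW N_ge2), true); rewrite /btw mdistxx add0r. Qed.

Lemma carries_total p : exists g, carries g p.
Proof.
have [h] := orbit_hull o p; rewrite -(fgw_val h).
elim: (val h) p => [|a w IHw] p.
  rewrite fgw0 ot_act1 => op; exists 1%g.
  have -> : p = ot_act 1%g o.
    rewrite ot_act1; apply/esym/mdist_positivity; move: op;
      rewrite /btw mdistxx.
    by have := mdist_ge0 o p; have := mdist_ge0 p o; lra.
  exact: carries_self.
rewrite -cat1s fgw_cat; case/(btw_split treeT (ot_act (fgw [:: a]) o)).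
  by move=> op; exists 1%g, a; rewrite ot_act1 mul1g.
rewrite ot_actM -[p in btw _ p _](ot_actKV (fgw [:: a])) => /btw_act/IHw[g gp].
by exists (fgw [:: a] * g)%g; rewrite -[p](ot_actKV (fgw [:: a]));
  exact: carriesM.
Qed.

Lemma carries_near g p : carries g p -> d (ot_act g o) p <= displ_letter.
Proof.
move=> [a ap]; apply: le_trans (displ_letterP a).
rewrite /displ -(ot_isometric g o) -ot_actM -ap lerDl; exact: mdist_ge0.
Qed.

(** Freeness and discreteness at [q]: only one [g] moves the points near [q]
    to points near [p]. *)
Lemma few_returns p q : exists e : R, exists n : nat, 0 < e /\
  forall p' q' g, d p p' < e -> d q q' < e -> d p' (ot_act g q') < e ->
    (fgsize g <= n)%N.
Proof.
have [e e0 eP] := ot_discrete q; pose E := e / 8.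
have E0 : 0 < E by rewrite divr_gt0.
have EE : e = 8 * E by rewrite /E mulrC divfK.
have key p' q' g : d p p' < E -> d q q' < E -> d p' (ot_act g q') < E ->
    d p (ot_act g q) < 3 * E.
  move=> pp qq pq; have := metric_triangle p p' (ot_act g q).
  have := metric_triangle p' (ot_act g q') (ot_act g q).
  by rewrite ot_isometric (metric_sym q'); lra.
have [[g0 g0P]|no] := pselect (exists g, d p (ot_act g q) < 3 * E); last first.
  exists E, 0%N; split=> // p' q' g pp qq pq; case: no; exists g;
    exact: key pp qq pq.
exists E, (fgsize g0); split=> // p' q' g pp qq pq.
suff : ot_act (g0^-1 * g)%g q = q.
  by move=> /ot_free /(canRL (mulVKg _)); rewrite mulg1 => ->.
apply: eP; rewrite ot_actM -(ot_isometric g0) ot_actKV.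
have := metric_triangle (ot_act g0 q) p (ot_act g q).
by have := key _ _ _ pp qq pq; rewrite (metric_sym _ p) EE; lra.
Qed.

(** By compactness: translates of the fundamental compact set which are close
    to each other differ by one of finitely many group elements. *)
Lemma carries_close : exists n : nat, forall g h p q,
  carries g p -> carries h q -> d p q < n.+1%:R^-1 ->
    (fgsize (g^-1 * h)%g <= n)%N.
Proof.
pose K (a : 'I_N * bool) := [set p | btw o p (ot_act (fgw [:: a]) o)].
have cK a : near_covering (K a).
  by apply/compact_near_coveringP; exact: tree_segment_compact treeT _ _.
have [n0 _ nP] : \forall n \near \oo, forall a b, K a `<=`
    [set p | forall q, K b q -> forall g, d p (ot_act g q) < n.+1%:R^-1 ->
      (fgsize g <= n)%N].
  apply: filter_forall => a; apply: filter_forall => b.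
  pose Q (i : T * nat) q := forall g,
    d i.1 (ot_act g q) < i.2.+1%:R^-1 -> (fgsize g <= i.2)%N.
  apply: (cK a nat \oo (fun n p => K b `<=` Q (p, n))) => p _.
  apply: (cK b (T * nat)%type (filter_prod (nbhs p) \oo) Q) => q _.
  have [e [n [e0 enP]]] := few_returns p q.
  pose n1 := maxn n (Num.truncn e^-1).+1.
  exists ([set q' | d q q' < e], [set i : T * nat | d p i.1 < e /\
    (n1 <= i.2)%N]).
    split=> /=; first by apply/metricType_numDomainType.nbhs_mdistP; exists e.
    exists ([set p' | d p p' < e], [set i : nat | (n1 <= i)%N]) => //=.
    split; first by apply/metricType_numDomainType.nbhs_mdistP; exists e.
    by exists n1.
  move=> [q' [p' m]] /= [qq [pp]]; rewrite geq_max => /andP[nm em] g pq.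
  apply: leq_trans nm; apply: (enP p' q') => //; apply: lt_trans pq _.
  rewrite invf_plt ?posrE ?ltr0n //; apply: lt_trans (truncnS_gt _) _.
  by rewrite ltr_nat ltnS.
exists n0 => g h p q [a ap] [b bq] pq.
apply: (nP n0 (leqnn _) a b (ot_act g^-1%g p) _ (ot_act h^-1%g q)).
- by apply/(btw_act g); rewrite ot_actKV -ot_actM.
- by apply/(btw_act h); rewrite ot_actKV -ot_actM.
- by rewrite -(ot_isometric g) -!ot_actM mulVKg mulgV !(ot_act1, ot_actM)
  ot_actKV.
Qed.

(** [s i] carries the [i]-th point of a fine subdivision of the segment from
    [o] to [h o], so that [carries_close] bounds the jumps. *)
Lemma segment_chain : exists n : nat, forall h, exists (k : nat) (s : nat -> F),
  [/\ s 0%N = 1%g, s k = h, k%:R <= displ h * n.+1%:R + 1,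
      forall i, (i < k)%N -> (fgsize ((s i)^-1 * s i.+1)%g <= n)%N &
      forall i, (i <= k)%N -> exists2 p, btw o p (ot_act h o) &
        d (ot_act (s i) o) p <= displ_letter].
Proof.
have [n nP] := carries_close; exists n => h.
have [g [gP gd _]] := btw_param treeT o (ot_act h o);
  rewrite -/(displ h) in gP gd.
pose D := displ h; have D0 : 0 <= D by exact: displ_ge0.
pose k := (Num.truncn (D * n.+1%:R)).+1.
have kR : 0 < k%:R :> R by rewrite ltr0n.
have Dn0 : 0 <= D * n.+1%:R by rewrite mulr_ge0.
have Dk : D * n.+1%:R < k%:R by rewrite truncnS_gt.
pose t (i : nat) : R := D * i%:R / k%:R.
have tk : t k = D by rewrite /t mulfK ?gt_eqF.
have t0 : t 0%N = 0 by rewrite /t mulr0 mul0r.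
have tm i j : (i <= j)%N -> t i <= t j.
  by move=> ij; rewrite /t ler_wpM2r ?invr_ge0 // ler_wpM2l // ler_nat.
have tge0 i : 0 <= t i by rewrite -t0 tm.
pose s i := if i == 0%N then 1%g else if i == k then h
            else projT1 (cid (carries_total (g (t i)))).
have sP i : (i <= k)%N -> carries (s i) (g (t i)).
  move=> ik; rewrite /s; case: eqP => [->|_].
    rewrite t0; have [/mdist_positivity <- _] := gP 0 (lexx _) D0.
    by have := carries_self 1%g; rewrite ot_act1.
  case: eqP => [->|_]; last by case: cid.
  rewrite tk; have [oD] := gP D D0 (lexx _); rewrite /btw oD -/(displ h) -/D.
  move=> e; have /mdist_positivity -> : d (g D) (ot_act h o) = 0 by lra.
  exact: carries_self.
exists k, s; split=> //.
- by rewrite /s eqxx; case: eqP => // k0; move: kR; rewrite k0 ltxx.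
- by rewrite /k -[X in X%:R]addn1 natrD lerD2r truncn_le.
- move=> i ik; apply: nP (sP _ (ltnW ik)) (sP _ ik) _.
  rewrite gd ?tm //; last by rewrite -/D -tk tm.
  rewrite /t -mulrBl -mulrBr -[i.+1]addn1 natrD addrAC subrr add0r mulr1.
  by rewrite ltr_pdivrMr // ltr_pdivlMl ?ltr0n // mulrC.
- move=> i ik; exists (g (t i)); last exact/carries_near/sP.
  by have [] := gP (t i) (tge0 i) _; rewrite // -/D -tk tm.
Qed.

(** Bounded cancellation: the chain along the segment from [o] to [u v o] has
    to come near [u], so the segment passes near [u o]. *)
Lemma displ_cat : exists2 C : R, 0 <= C & forall u v, reduced (u ++ v) ->
  displ (fgw u) + displ (fgw v) <= displ (fgw (u ++ v)) + C.
Proof.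
have [n nP] := segment_chain; have M0 := displ_letter_ge0.
exists ((displ_letter * n%:R + displ_letter) *+ 2);
  first by rewrite mulrn_wge0 ?addr_ge0 ?mulr_ge0.
move=> u v ruv; have [k [s [s0 sk _ jump near]]] := nP (fgw (u ++ v)).
have [i ik iu] := chain_near_prefix ruv s0 sk jump.
have [p op sp] := near i ik.
have : d p (ot_act (fgw u) o) <= displ_letter * n%:R + displ_letter.
  rewrite (le_trans (metric_triangle _ (ot_act (s i) o) _)) // addrC.
  rewrite (metric_sym p) lerD // mdist_orbit (le_trans (displ_fgsize _)) //.
  by rewrite ler_wpM2l // ler_nat.
have := metric_triangle o p (ot_act (fgw u) o).
have := metric_triangle (ot_act (fgw u) o) p (ot_act (fgw (u ++ v)) o).
rewrite mdist_orbit {1}fgw_cat mulKg -/(displ (fgw u)) (metric_sym _ p).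
by move: op; rewrite /btw -/(displ _); lra.
Qed.

(** The action is proper: a short segment gives a short chain. *)
Lemma displ_proper (r : R) : exists n : nat, forall g, (n <= fgsize g)%N ->
  r < displ g.
Proof.
have [n nP] := segment_chain.
exists (Num.truncn ((`|r| * n.+1%:R + 1) * n%:R)).+1 => h hn; rewrite ltNge;
  apply/negP => hr.
have [k [s [s0 sk kD jump _]]] := nP h.
have si i : (i <= k)%N -> (fgsize (s i) <= i * n)%N.
  elim: i => [|i IHi] ik; first by rewrite s0.
  rewrite -(mulVKg (s i) (s i.+1)) (leq_trans (fgsizeM _ _)) // mulSn addnC.
  by rewrite leq_add ?jump ?IHi // ltnW.
have hk := si k (leqnn _); rewrite sk in hk.
have : (Num.truncn ((`|r| * n.+1%:R + 1) * n%:R)).+1%:R <= (`|r| * n.+1%:R + 1)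
  * n%:R.
  apply: (@le_trans _ _ (fgsize h)%:R); first by rewrite ler_nat.
  apply: (@le_trans _ _ (k * n)%:R); first by rewrite ler_nat.
  rewrite natrM ler_wpM2r // (le_trans kD) // lerD2r ler_wpM2r //.
  by rewrite (le_trans hr) // ler_norm.
by rewrite leNgt truncnS_gt.
Qed.

End OuterTrees.

Section TranslationLength.
Variables (R : realType) (N : nat) (T : outer_tree R N) (o : T).
Local Notation d := (@mdist R T).
Implicit Types (g h : free_group N) (w : seq (letter N)).

Lemma translation_length_le g : translation_length T g <= displ o g.
Proof.
apply: ge_inf; last by exists o.
by exists 0 => _ [p _ <-]; exact: mdist_ge0.
Qed.

Lemma translation_lengthJ g h : translation_length T (g ^ h)%g =
  translation_length T g.
Proof.
congr inf; apply/seteqP; split=> _ [p _ <-].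
  exists (ot_act h p) => //; rewrite -(ot_isometric h^-1%g) -!ot_actM mulVg
    ot_act1.
  by rewrite /conjg mulgA.
exists (ot_act h^-1%g p) => //; rewrite -(ot_isometric h) -!ot_actM mulgV
  ot_act1.
by rewrite /conjg !mulgA mulgV mul1g mulgK.
Qed.

Lemma length_spectrum_conj g : length_spectrum T (conj_class g) =
  translation_length T g.
Proof.
by rewrite /length_spectrum; have [h ->] := repr_conj_class g;
  rewrite translation_lengthJ.
Qed.

Lemma mdist_exp g p n : d p (ot_act (g ^+ n)%g p) <= n%:R * d p (ot_act g p).
Proof.
elim: n => [|n IHn]; first by rewrite expg0 ot_act1 mdistxx mul0r.
rewrite expgS ot_actM -[n.+1]add1n natrD mulrDl mul1r.
by rewrite (le_trans (metric_triangle _ (ot_act g p) _)) // lerD2l ot_isometric.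
Qed.

(** For a cyclically reduced word the displacement of [o] by the [n]-th power
    is at least [n] times [displ o (fgw w) - C], so that no point moves by
    less. *)
Lemma translation_length_ge (C : R) w :
    (forall u v, reduced (u ++ v) ->
      displ o (fgw u) + displ o (fgw v) <= displ o (fgw (u ++ v)) + C) ->
    reduced (w ++ w) ->
  displ o (fgw w) - C <= translation_length T (fgw w).
Proof.
move=> CP rw; set e := displ o (fgw w) - C.
have eP n : n%:R * e <= displ o (fgw w ^+ n)%g.
  rewrite -fgw_exp; elim: n => [|n IHn]; first by rewrite mul0r displ_ge0.
  have := CP w _ (reduced_exp n rw); rewrite /= -[n.+1]add1n natrD mulrDl mul1r.
  by move: IHn; rewrite /e; lra.
apply: lb_le_inf; first by exists (d o (ot_act (fgw w) o)), o.
move=> _ [p _ <-]; rewrite leNgt; apply/negP => lt_e.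
pose D := d o p + d o p; have D0 : 0 <= D by rewrite addr_ge0 ?mdist_ge0.
pose f := e - d p (ot_act (fgw w) p); have f0 : 0 < f by rewrite subr_gt0.
pose n := (Num.truncn (D / f)).+1.
have : D / f < n%:R by rewrite truncnS_gt.
rewrite ltr_pdivrMr // ltNge => /negP; apply.
rewrite /f mulrBr lerBlDr (le_trans (eP n)) // addrC -lerBlDr.
apply: le_trans (mdist_exp _ _ n).
have := metric_triangle o p (ot_act (fgw w ^+ n)%g o).
have := metric_triangle p (ot_act (fgw w ^+ n)%g p) (ot_act (fgw w ^+ n)%g o).
by rewrite ot_isometric (metric_sym p o) -/(displ o _) /D; lra.
Qed.

End TranslationLength.

(** * Branch points and isometries between orbits *)

Section TreeDistances.
Variables (R : realType) (T : metricType R).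
Hypothesis treeT : is_real_tree T.
Local Notation d := (@mdist R T).
Implicit Types (x y z p q m : T).

(** Coming from [z], the segment from [x] to [y] is met on one side of [p],
    and then the path from [z] to the other end goes through [p]. *)
Lemma btw_dist x p y z : btw x p y ->
  d p z = Num.max (d x z - d x p) (d y z - d y p).
Proof.
move=> xpy; apply/eqP; rewrite eq_le ge_max le_max; apply/andP; split;
  last first.
  have := metric_triangle x p z; have := metric_triangle y p z => h1 h2.
  by apply/andP; split; rewrite lerBlDl.
have [xz|zy] := btw_split treeT z xpy; apply/orP.
  by left; move: xz; rewrite /btw; lra.
by right; move: (btwC zy); rewrite /btw; lra.
Qed.

(** The segment from [z] to [y] follows the one from [z] to [x] until a
    distance at most [C] from [x], hence beyond [m]. *)
Lemma btw_extend (C : R) z m x y : btw z m x -> d z x + d x y <= d z y + C ->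
  C < d m x -> btw z m y.
Proof.
move=> zmx zxy Cmx; apply/eqP; rewrite eq_le metric_triangle andbT.
have := metric_triangle z m y; have := mdist_ge0 m x.
move: zmx; rewrite /btw.
have s1 := metric_sym y x; have s2 := metric_sym y z; have s3 := metric_sym m z.
by have [] := tree_4point treeT m y z x; lra.
Qed.

End TreeDistances.

Section MedianDistance.
Variables (R : realType).

(** In a tree the only such [m] is the branch point of the three points. *)
Definition median (T : metricType R) (z : 'I_3 -> T) (m : T) : Prop :=
  forall i j, i != j -> btw (z i) m (z j).

Lemma ord3_cases (i : 'I_3) : [\/ i = 0, i = 1 | i = 2%:R].
Proof.
by case: i => [[|[|[|//]]] hi]; [apply: Or31|apply: Or32|apply: Or33];
  apply/val_inj.
Qed.

Lemma median_exists (T : metricType R) (z : 'I_3 -> T) :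
  is_real_tree T -> exists m, median z m.
Proof.
move=> treeT; have [m [h01 h02 h12]] := tree_median treeT (z 0) (z 1) (z 2%:R).
exists m => i j; have [->|->|->] := ord3_cases i; have [->|->|->] :=
  ord3_cases j => //.
- by move=> _; exact: btwC.
- by move=> _; exact: btwC.
- by move=> _; exact: btwC.
Qed.

(** When [m] is the branch point, the largest of these is the distance from
    [q] to [m]. *)
Definition median_term (T : metricType R) (z : 'I_3 -> T) (q : T) i j : R :=
  (mdist q (z i) + mdist q (z j) - mdist (z i) (z j)) / 2.

Lemma median_term_le (T : metricType R) (z : 'I_3 -> T) (m q : T) i j :
  median z m -> i != j -> median_term z q i j <= mdist q m.
Proof.
move=> zm ij; have := zm i j ij; rewrite /median_term /btw.
have := metric_triangle q m (z i); have := metric_triangle q m (z j).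
rewrite (metric_sym m (z i)); lra.
Qed.

(** At least two of the three segments from [q] to the [z i] go through
    [m]. *)
Lemma median_term_eq (T : metricType R) (z : 'I_3 -> T) (m q : T) :
    is_real_tree T -> median z m ->
  exists i j, i != j /\ mdist q m = median_term z q i j.
Proof.
move=> treeT zm; pose good i := btw q m (z i).
have two i j : i != j -> good i \/ good j.
  move=> ij; case: (btw_split treeT q (zm i j ij)) => h; [left|right] => //.
  exact: btwC.
have fin i j : i != j -> good i -> good j ->
    exists i j, i != j /\ mdist q m = median_term z q i j.
  move=> ij gi gj; exists i, j; split=> //; move: gi gj (zm i j ij).
  rewrite /good /btw /median_term (metric_sym (z i) m); lra.
have [g0|g1] := two 0 1 isT.
  have [g1|g2] := two 1 2%:R isT; first exact: (fin 0 1).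
  exact: (fin 0 2%:R).
have [g0|g2] := two 0 2%:R isT; first exact: (fin 0 1).
exact: (fin 1 2%:R).
Qed.

Lemma median_dist (T1 T2 : metricType R) (z1 : 'I_3 -> T1) (z2 : 'I_3 -> T2)
    (m1 q1 : T1) (m2 q2 : T2) (c : R) :
    is_real_tree T1 -> is_real_tree T2 -> median z1 m1 -> median z2 m2 ->
    (forall i j, i != j -> median_term z1 q1 i j = median_term z2 q2 i j + c) ->
  mdist q1 m1 = mdist q2 m2 + c.
Proof.
move=> tr1 tr2 zm1 zm2 e; apply/eqP; rewrite eq_le; apply/andP; split.
  have [i [j [ij ->]]] := median_term_eq q1 tr1 zm1.
  by rewrite e // lerD2r median_term_le.
have [i [j [ij ->]]] := median_term_eq q2 tr2 zm2.
by rewrite -e // median_term_le.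
Qed.

End MedianDistance.

Section OrbitIsometry.
Variables (R : realType) (N : nat).

(** A point of a tree spanned by the orbit of [m] is determined by its
    distances to the orbit, which therefore match the points of two trees. *)
Definition same_position (T1 T2 : outer_tree R N) (m1 p1 : T1) (m2 p2 : T2) :
  Prop :=
  forall g, mdist p1 (ot_act g m1) = mdist p2 (ot_act g m2).

Lemma same_position_exists (T1 T2 : outer_tree R N) (m1 : T1) (m2 : T2) :
    same_position m1 m1 m2 m2 ->
  forall p1, exists p2, same_position m1 p1 m2 p2.
Proof.
move=> mm p1; have [g gp] := orbit_hull m1 p1.
have [c [cP _ _]] := btw_param (ot_real_tree T2) m2 (ot_act g m2).
have [|e1 e2] := cP (mdist m1 p1) (mdist_ge0 _ _).
  by rewrite -mm -gp lerDl mdist_ge0.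
exists (c (mdist m1 p1)) => h.
rewrite (btw_dist (ot_real_tree T1) _ gp) (btw_dist (ot_real_tree T2) _ e2) e1.
rewrite mm; congr (Num.max _ (_ - _)).
  have := mm (g^-1 * h)%g; rewrite !ot_actM -(ot_isometric g)
    -[RHS](ot_isometric g).
  by rewrite !ot_actKV.
move: gp e2; rewrite /btw e1 mm (metric_sym p1) (metric_sym (c _)); lra.
Qed.

Lemma same_position_dist (T1 T2 : outer_tree R N) (m1 p1 q1 : T1)
  (m2 p2 q2 : T2) :
    same_position m1 m1 m2 m2 ->
    same_position m1 p1 m2 p2 -> same_position m1 q1 m2 q2 ->
  mdist p1 q1 = mdist p2 q2.
Proof.
move=> mm pp qq; have [g gp1] := orbit_hull m1 p1.
have pm : mdist m1 p1 = mdist m2 p2.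
  by have := pp 1%g; rewrite !ot_act1 metric_sym (metric_sym p2).
have qm : mdist m1 q1 = mdist m2 q2.
  by have := qq 1%g; rewrite !ot_act1 metric_sym (metric_sym q2).
have gp2 : btw m2 p2 (ot_act g m2).
  by move: gp1; rewrite /btw pm pp mm.
rewrite (btw_dist (ot_real_tree T1) _ gp1) (btw_dist (ot_real_tree T2) _ gp2).
by rewrite pm qm 2!(metric_sym (ot_act g m1)) 2!(metric_sym (ot_act g m2)) pp
  qq.
Qed.

Lemma same_position_sym (T1 T2 : outer_tree R N) (m1 p1 : T1) (m2 p2 : T2) :
  same_position m1 p1 m2 p2 -> same_position m2 p2 m1 p1.
Proof. by move=> pp g; rewrite pp. Qed.

Lemma orbit_isometry (T1 T2 : outer_tree R N) (m1 : T1) (m2 : T2) :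
  same_position m1 m1 m2 m2 -> outer_eq T1 T2.
Proof.
move=> mm; have [f fP] := choice (same_position_exists mm).
have iso p q : mdist (f p) (f q) = mdist p q.
  by apply/esym/(same_position_dist mm); exact: fP.
exists f; split=> //.
  split=> // [p q _ _ pq|q _].
    by apply: mdist_positivity; rewrite -iso pq mdistxx.
  have [p pq] := same_position_exists (same_position_sym mm) q.
  exists p => //; apply: mdist_positivity.
  by rewrite -(same_position_dist mm (fP p) (same_position_sym pq)) mdistxx.
move=> g p; apply: mdist_positivity.
have gfp : same_position m1 (ot_act g p) m2 (ot_act g (f p)).
  move=> h; have := fP p (g^-1 * h)%g; rewrite !ot_actM.
  by rewrite -(ot_isometric g) -[RHS](ot_isometric g) !ot_actKV.
by rewrite -(same_position_dist mm (fP _) gfp) mdistxx.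
Qed.

End OrbitIsometry.

(** * Displacement functions at bounded distance *)

Section BoundedDifference.
Variables (R : realType) (N : nat) (N_ge2 : (2 <= N)%N).
Variables (T1 T2 : outer_tree R N) (o1 : T1) (o2 : T2).
Local Notation word := (seq (letter N)).
Implicit Types (a b : letter N) (p q u v w : word).

Definition delta w : R := displ o1 (fgw w) - displ o2 (fgw w).

Variable C : R.
Hypothesis C_ge0 : 0 <= C.
Hypothesis C1 : forall u v, reduced (u ++ v) ->
  displ o1 (fgw u) + displ o1 (fgw v) <= displ o1 (fgw (u ++ v)) + C.
Hypothesis C2 : forall u v, reduced (u ++ v) ->
  displ o2 (fgw u) + displ o2 (fgw v) <= displ o2 (fgw (u ++ v)) + C.

(** The cancellation at the two ends of a long word cannot eat it up. *)
Definition long w : Prop := 2 * C < displ o1 (fgw w) /\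
  2 * C < displ o2 (fgw w).

Lemma long_size : exists n, forall w, reduced w -> (n <= size w)%N -> long w.
Proof.
have [n1 n1P] := displ_proper N_ge2 o1 (2 * C).
have [n2 n2P] := displ_proper N_ge2 o2 (2 * C).
exists (maxn n1 n2) => w rw; rewrite geq_max => /andP[wn1 wn2].
by split; [apply: n1P|apply: n2P]; rewrite fgsize_fgw.
Qed.

Lemma long_neq0 w : long w -> w != [::].
Proof. by move=> [lw _]; apply: contraTneq lw => ->;
  rewrite fgw0 displ1 -leNgt mulr_ge0. Qed.

Lemma delta_inv w : delta (invw w) = delta w.
Proof. by rewrite /delta fgw_inv !displV. Qed.

(** The paths read from [u p] and from [p v] overlap along [p], and when [p]
    is long the four-point condition computes the distance between the far
    ends. *)
Lemma displ_overlap (T : outer_tree R N) (o : T) u p v :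
    (forall u v, reduced (u ++ v) ->
      displ o (fgw u) + displ o (fgw v) <= displ o (fgw (u ++ v)) + C) ->
    2 * C < displ o (fgw p) -> reduced (u ++ p) -> reduced (p ++ v) ->
  displ o (fgw (u ++ p ++ v)) =
    displ o (fgw (u ++ p)) + displ o (fgw (p ++ v)) - displ o (fgw p).
Proof.
move=> CT lp rup rpv; have h1 := CT _ _ rup; have h2 := CT _ _ rpv.
have := tree_4point (ot_real_tree T) o (ot_act (fgw (u ++ p)) o)
  (ot_act (fgw u) o) (ot_act (fgw (u ++ p ++ v)) o).
have := tree_4point (ot_real_tree T) o (ot_act (fgw (u ++ p ++ v)) o)
  (ot_act (fgw u) o) (ot_act (fgw (u ++ p)) o).
rewrite (metric_sym (ot_act (fgw (u ++ p ++ v)) o)).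
rewrite (metric_sym (ot_act (fgw (u ++ p)) o) (ot_act (fgw u) o)).
rewrite (metric_sym (ot_act (fgw (u ++ p ++ v)) o) (ot_act (fgw u) o)).
rewrite !mdist_orbit -!/(displ o _) !(fgw_cat u) !mulKg.
rewrite (fgw_cat p v) (mulgA (fgw u)) mulKg -(fgw_cat p v).
have := displ_ge0 o (fgw p).
move: h1 h2; rewrite (fgw_cat u p) => h1 h2 p0.
by case=> e1; case=> e2; move: h1 h2 p0 e1 e2 lp C_ge0; lra.
Qed.

Lemma delta_overlap u p v : long p -> reduced (u ++ p) -> reduced (p ++ v) ->
  delta (u ++ p ++ v) = delta (u ++ p) + delta (p ++ v) - delta p.
Proof.
move=> [lp1 lp2] rup rpv.
by rewrite /delta (displ_overlap C1 lp1 rup rpv) (displ_overlap C2 lp2 rup rpv);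
  lra.
Qed.

Hypothesis delta_bounded : exists B, forall w, reduced w -> `|delta w| <= B.

(** Winding [k] times along [p v] changes [delta] by [k] times a constant,
    which therefore vanishes. *)
Lemma delta_loop p v : long p -> reduced (p ++ v ++ p) -> delta (p ++ v ++ p) =
  delta p.
Proof.
move=> lp rpvp; have [B BP] := delta_bounded; have p0 := long_neq0 lp.
pose e := delta (p ++ v ++ p) - delta p.
pose r k := flatten (nseq k (v ++ p)).
have rr k : reduced (p ++ r k).
  elim: k => [|k IHk]; first by rewrite cats0; exact: reduced_catl rpvp.
  by rewrite /r /= -/(r k) -catA (catA p); apply: reduced_cat3; rewrite -?catA.
have dr k : delta (p ++ r k) = delta p + k%:R * e.
  elim: k => [|k IHk]; first by rewrite cats0 mul0r addr0.
  rewrite /r /= -/(r k) -catA (catA p) delta_overlap -?catA //.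
  by rewrite IHk -[k.+1]add1n natrD mulrDl mul1r /e; lra.
have bnd k : k%:R * `|e| <= B + B.
  have := BP _ (rr k); have := BP p (reduced_catl rpvp); rewrite dr => h1 h2.
  have -> : k%:R * `|e| = `|k%:R * e| by rewrite normrM (@ger0_norm _ k%:R).
  rewrite (_ : k%:R * e = (delta p + k%:R * e) - delta p);
    last by rewrite addrC addKr.
  by rewrite (le_trans (ler_normB _ _)) // lerD.
apply/eqP; rewrite -subr_eq0 -/e; apply/negPn/negP => e0.
have {}e0 : 0 < `|e| by rewrite normr_gt0.
have := bnd (Num.truncn ((B + B) / `|e|)).+1.
by rewrite -ler_pdivlMr // leNgt truncnS_gt.
Qed.

(** Cut the loop [p v q w] at [q]. *)
Lemma delta_two p q v w : long p -> long q ->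
    reduced (p ++ v ++ q) -> reduced (q ++ w ++ p) ->
  delta (p ++ v ++ q) + delta (q ++ w ++ p) = delta p + delta q.
Proof.
move=> lp lq r1 r2.
have r : reduced ((p ++ v) ++ q ++ (w ++ p)).
  by apply: reduced_cat3; rewrite -?catA // long_neq0.
have e1 := @delta_loop p (v ++ q ++ w) lp; rewrite -!catA in e1 r.
have := @delta_overlap (p ++ v) q (w ++ p) lq; rewrite -!catA => /(_ r1 r2).
by rewrite (e1 r); lra.
Qed.

(** Think of [p] and [q] as long powers of two letters, hence as two ends of
    the tree. Then [delta] is constant on the pairs of points near given ends,
    and its values on the three kinds of pairs satisfy the relation of a
    coboundary. *)
Lemma delta_flanked p q v1 v3 v4 : long p -> long q -> reduced (p ++ invw q) ->
    reduced (invw q ++ v1 ++ p) -> reduced (invw q ++ v3 ++ q) ->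
    reduced (invw p ++ v4 ++ p) ->
  2 * delta (invw q ++ v1 ++ p) =
    delta (invw q ++ v3 ++ q) + delta (invw p ++ v4 ++ p).
Proof.
move=> lp lq rpq r1 r3 r4.
have long_inv x : long x -> long (invw x) by rewrite /long fgw_inv !displV.
have lp' := long_inv _ lp; have lq' := long_inv _ lq.
have rqp : reduced (q ++ invw p) by rewrite -reduced_invw invw_cat invwK.
have r5 : reduced ((invw p ++ v4) ++ p ++ invw q).
  by apply: reduced_cat3; rewrite -?catA // long_neq0.
have r6 : reduced (q ++ invw p ++ (v4 ++ p ++ invw q)).
  by apply: reduced_cat3; rewrite ?catA -?catA // ?long_neq0 //;
    rewrite -catA in r5.
have e1 := delta_two lq' lp r1 (w := [::]) rpq.
have e2 := delta_two lq' lq r3 (w := invw p ++ v4 ++ p) _.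
move: e2; rewrite -!catA => /(_ r6).
rewrite (delta_overlap lp' rqp) -?catA //; last by rewrite -catA in r5.
rewrite (catA (invw p)) (delta_overlap lp) -?catA //.
have -> : delta (q ++ invw p) = delta (p ++ invw q).
  by rewrite -[RHS]delta_inv invw_cat invwK.
by move: e1; rewrite /= !delta_inv; lra.
Qed.

End BoundedDifference.

Section MedianOrbit.
Variables (R : realType) (N : nat) (T : outer_tree R N) (o : T) (C : R).
Local Notation word := (seq (letter N)).
Hypothesis C_ge0 : 0 <= C.
Hypothesis CT : forall u v, reduced (u ++ v) ->
  displ o (fgw u) + displ o (fgw v) <= displ o (fgw (u ++ v)) + C.
Variable x : 'I_3 -> word.
Hypothesis x_diverge : forall i j, i != j -> reduced (invw (x i) ++ x j).
Hypothesis x_long : forall i, 2 * C < displ o (fgw (x i)).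

Lemma mdist_orbit_words u v :
  mdist (ot_act (fgw u) o) (ot_act (fgw v) o) = displ o (fgw (invw u ++ v)).
Proof. by rewrite mdist_orbit fgw_cat fgw_inv. Qed.

Lemma median_away m i : median (fun i => ot_act (fgw (x i)) o) m ->
  C < mdist m (ot_act (fgw (x i)) o).
Proof.
move=> xm; have [j [k [ij ik jk]]] : exists j k, [/\ i != j, i != k & j != k].
  have [->|->|->] := ord3_cases i.
  - by exists 1, 2%:R.
  - by exists 0, 2%:R.
  - by exists 0, 1.
have h j' : i != j' -> displ o (fgw (x i)) + displ o (fgw (x j')) <=
    mdist (ot_act (fgw (x i)) o) (ot_act (fgw (x j')) o) + C.
  move=> ij'; rewrite mdist_orbit_words; apply: le_trans (CT (x_diverge ij')).
  by rewrite fgw_inv displV.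
have := metric_triangle (ot_act (fgw (x j)) o) o (ot_act (fgw (x k)) o).
rewrite (metric_sym (ot_act (fgw (x j)) o) o) -!/(displ o _).
move: (xm _ _ ij) (xm _ _ ik) (xm _ _ jk) (h j ij) (h k ik) (x_long i);
  rewrite /btw.
rewrite (metric_sym (ot_act (fgw (x i)) o) m) (metric_sym (ot_act (fgw (x j)) o)
  m); lra.
Qed.

(** Cancellation takes place within [C] of the points [x i o], and [m] is
    further away from them. *)
Lemma median_prolong m (v : 'I_3 -> word) :
    median (fun i => ot_act (fgw (x i)) o) m -> (forall i, reduced (x i ++ v i))
      ->
  median (fun i => ot_act (fgw (x i ++ v i)) o) m.
Proof.
move=> xm rxv i j ij; have treeT := ot_real_tree T.
have x0 k : x k != [::].
  by apply: contraTneq (x_long k) => ->; rewrite fgw0 displ1 -leNgt mulr_ge0.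
have ji : j != i by rewrite eq_sym.
have r1 : reduced (invw (x j) ++ x i ++ v i) by apply: reduced_cat3;
  rewrite ?x_diverge.
have r2 : reduced (invw (x i ++ v i) ++ x j ++ v j).
  apply: reduced_cat3 => //.
  by rewrite -reduced_invw invw_cat invwK.
have beyond u k : reduced (invw u ++ x k ++ v k) ->
    mdist (ot_act (fgw u) o) (ot_act (fgw (x k)) o) +
    mdist (ot_act (fgw (x k)) o) (ot_act (fgw (x k ++ v k)) o) <=
    mdist (ot_act (fgw u) o) (ot_act (fgw (x k ++ v k)) o) + C.
  move=> r; rewrite !mdist_orbit_words.
  rewrite (catA (invw u)) in r; rewrite (catA (invw u)).
  apply: le_trans (CT r); rewrite lerD2l.
  by rewrite catA fgw_cat [in leLHS]fgw_cat fgw_inv mulVg mul1g.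
have h1 : btw (ot_act (fgw (x j)) o) m (ot_act (fgw (x i ++ v i)) o).
  by apply: (btw_extend treeT (xm _ _ ji) (beyond _ _ r1)); exact: median_away.
by apply: (btw_extend treeT (btwC h1) (beyond _ _ r2)); exact: median_away.
Qed.

End MedianOrbit.

Section BoundedRigid.
Variables (R : realType) (N : nat) (N_ge2 : (2 <= N)%N).
Variables (T1 T2 : outer_tree R N) (o1 : T1) (o2 : T2).
Local Notation word := (seq (letter N)).

(** The words start with [a], [b] and [a^-1] and end with [a] or [b]; in rank
    2 no other letter is at hand. *)
Lemma three_words (a b : letter N) n : b \notin [:: a; letter_inv a] ->
  exists x : 'I_3 -> word, [/\ forall i j, i != j ->
    reduced (invw (x i) ++ x j),
    forall i, (n <= size (x i) <= n.+2)%N,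
    forall i k, reduced (x i ++ nseq k a) & forall i k,
      reduced (x i ++ nseq k b)].
Proof.
rewrite !inE negb_or => /andP[ba bA].
have aA := letter_inv_neq a; have bB := letter_inv_neq b.
have aB : a != letter_inv b by rewrite -(inj_eq (can_inj (@letter_invK N)))
  letter_invK eq_sym.
pose hd (i : 'I_3) := if i == 0 then a else if i == 1 then b else letter_inv a.
pose tl (i : 'I_3) := if i == 0 then nseq n.+1 a else nseq n.+1 b.
have hd_inj i j : i != j -> hd i != hd j.
  rewrite /hd; have [->|->|->] := ord3_cases i; have [->|->|->] := ord3_cases j
    => //= _; by rewrite eq_sym.
have rtl i c k : c \in [:: a; b] -> reduced ((hd i :: tl i) ++ nseq k c).
  move=> cab; have ca : c != letter_inv a by move: cab; rewrite !inE =>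
    /orP[]/eqP->.
  have cb : c != letter_inv b by move: cab; rewrite !inE => /orP[]/eqP->.
  rewrite /hd /tl; have [->|->|->] := ord3_cases i => /=.
  - exact: (@reduced_nseq2 N a c n.+2).
  - exact: (@reduced_nseq2 N b c n.+2).
  - apply/andP; split; last exact: (@reduced_nseq2 N b c n.+1).
    by rewrite letter_invK.
have rx i : reduced (hd i :: tl i).
  by have := @rtl i a 0%N; rewrite cats0 inE eqxx; exact.
exists (fun i => hd i :: tl i); split=> //.
- by move=> i j /hd_inj h; exact: reduced_diverge h (rx i) (rx j).
- by move=> i; rewrite /= /tl; case: ifP; rewrite size_nseq; lia.
- by move=> i k; apply: rtl; rewrite inE eqxx.
- by move=> i k; apply: rtl; rewrite !inE eqxx orbT.
Qed.

(** The orbits of a suitable branch point are isometric: the distances between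
    far points of the two base orbits differ by a constant on each of the
    three kinds of pairs which are involved, and the constants cancel. *)
Lemma bounded_difference_eq :
    (exists B, forall w : word, reduced w -> `|delta o1 o2 w| <= B) ->
  outer_eq T1 T2.
Proof.
move=> bnd.
have [C1 C1_ge0 C1P] := displ_cat N_ge2 o1; have [C2 C2_ge0 C2P] :=
  displ_cat N_ge2 o2.
pose C := Num.max C1 C2; have C_ge0 : 0 <= C by rewrite le_max C1_ge0.
have {}C1P u v : reduced (u ++ v) ->
    displ o1 (fgw u) + displ o1 (fgw v) <= displ o1 (fgw (u ++ v)) + C.
  by move=> /C1P/le_trans; apply; rewrite lerD2l le_max lexx.
have {}C2P u v : reduced (u ++ v) ->
    displ o2 (fgw u) + displ o2 (fgw v) <= displ o2 (fgw (u ++ v)) + C.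
  by move=> /C2P/le_trans; apply; rewrite lerD2l le_max lexx orbT.
have [n0 n0P] := long_size N_ge2 o1 o2 C.
pose a : letter N := (Ordinal (ltnW N_ge2), true).
pose b : letter N := (Ordinal N_ge2, true).
have ba : b \notin [:: a; letter_inv a] by [].
have [x [x_div x_size xa xb]] := three_words n0 ba.
have ab : a != b by [].
have rx i : reduced (x i) by rewrite -[x i]cats0; exact: (xa i 0%N).
have x_long i : long o1 o2 C (x i) by apply: n0P => //; case/andP: (x_size i).
pose A := nseq n0 a; pose B := nseq n0 b.
have lA : long o1 o2 C A by apply: n0P; rewrite ?reduced_nseq ?size_nseq.
have lB : long o1 o2 C B by apply: n0P; rewrite ?reduced_nseq ?size_nseq.
have rAB : reduced (A ++ invw B) by rewrite invw_nseq reduced_nseq2.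
have key v1 v3 v4 := @delta_flanked _ _ _ _ _ _ _ C_ge0 C1P C2P bnd _ _ v1 v3 v4
  lA lB rAB.
have n00 : (0 < n0)%N.
  by have := long_neq0 C_ge0 lA; rewrite /A; case: (n0).
have r1 : reduced (invw B ++ [::] ++ A) by rewrite invw_nseq reduced_nseq2.
have r3 : reduced (invw B ++ [:: a] ++ B).
  rewrite invw_nseq; apply: reduced_cat3 => //;
    first exact: (reduced_nseq2 _ 1).
  exact: (@reduced_nseq2 _ a b 1).
have r4 : reduced (invw A ++ [:: b] ++ A).
  rewrite invw_nseq; apply: reduced_cat3 => //;
    first exact: (reduced_nseq2 _ 1).
  exact: (@reduced_nseq2 _ b a 1).
pose al := delta o1 o2 (invw A ++ [:: b] ++ A).
pose be := delta o1 o2 (invw B ++ [:: a] ++ B).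
(* [delta_flanked] with two of the three words fixed makes [delta] constant on
   the third. *)
have k1 v : reduced (invw B ++ v ++ A) -> delta o1 o2 (invw B ++ v ++ A) =
  (al + be) / 2.
  by move=> rv; have := key _ _ _ rv r3 r4; rewrite -/al -/be; lra.
have k3 v : reduced (invw B ++ v ++ B) -> delta o1 o2 (invw B ++ v ++ B) = be.
  by move=> rv; have := key _ _ _ r1 rv r4; rewrite k1 // -/al; lra.
have k4 v : reduced (invw A ++ v ++ A) -> delta o1 o2 (invw A ++ v ++ A) = al.
  by move=> rv; have := key _ _ _ r1 r3 rv; rewrite k1 // -/be; lra.
have [m1 m1P] := median_exists (fun i => ot_act (fgw (x i)) o1)
  (ot_real_tree T1).
have [m2 m2P] := median_exists (fun i => ot_act (fgw (x i)) o2)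
  (ot_real_tree T2).
apply: (orbit_isometry (m1 := m1) (m2 := m2)) => g.
(* The powers [b^n] and [a^n] survive on both sides of [(x i)^-1 g (x k)]. *)
pose n := (n0 + (n0.+2 + fgsize g + n0.+2)).+1.
pose y i := x i ++ nseq n b; pose z i := x i ++ nseq n a.
have same c : (forall i k, reduced (x i ++ nseq k c)) -> forall i j, i != j ->
    exists v, invw (x i ++ nseq n c) ++ (x j ++ nseq n c) =
      invw (nseq n0 c) ++ v ++ nseq n0 c /\
        reduced (invw (nseq n0 c) ++ v ++ nseq n0 c).
  move=> xc i j ij; exists (invw (nseq (n - n0) c) ++ invw (x i) ++ x j ++
    nseq (n - n0) c).
  have e : invw (x i ++ nseq n c) ++ (x j ++ nseq n c) = invw (nseq n0 c) ++
      (invw (nseq (n - n0) c) ++ invw (x i) ++ x j ++ nseq (n - n0) c) ++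
        nseq n0 c.
    rewrite (@nseq_split _ n0 n c); last by rewrite /n; lia.
    by rewrite !invw_cat -!catA.
  split=> //; rewrite -e; apply: reduced_cat3 => //; last first.
    by apply: contraTneq (n00) => xj0; have := x_div j i; have := x_size j;
      rewrite xj0; case: (n0).
  rewrite -reduced_invw invw_cat invwK; apply: reduced_cat3 => //.
    by rewrite -reduced_invw invw_cat invwK x_div.
  by apply: contraTneq (n00) => xj0; have := x_size i; rewrite xj0; case: (n0).
have yd i j : i != j -> mdist (ot_act (fgw (y i)) o1) (ot_act (fgw (y j)) o1) =
    mdist (ot_act (fgw (y i)) o2) (ot_act (fgw (y j)) o2) + be.
  move=> ij; rewrite !mdist_orbit_words; have [v [-> rv]] := same b xb i j ij.
  by rewrite -(k3 v rv) /delta; lra.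
have zd i j : i != j -> mdist (ot_act (fgw (z i)) o1) (ot_act (fgw (z j)) o1) =
    mdist (ot_act (fgw (z i)) o2) (ot_act (fgw (z j)) o2) + al.
  move=> ij; rewrite !mdist_orbit_words; have [v [-> rv]] := same a xa i j ij.
  by rewrite -(k4 v rv) /delta; lra.
have gzy i k : mdist (ot_act g (ot_act (fgw (z k)) o1)) (ot_act (fgw (y i)) o1)
  =
    mdist (ot_act g (ot_act (fgw (z k)) o2)) (ot_act (fgw (y i)) o2) +
      (al + be) / 2.
  rewrite metric_sym [in RHS]metric_sym -!ot_actM !mdist_orbit.
  have h : (n0 + fgsize ((fgw (x i))^-1 * g * fgw (x k))%g < n)%N.
    rewrite ltnS leq_add2l (leq_trans (fgsizeM _ _)) // leq_add //.
      rewrite (leq_trans (fgsizeM _ _)) // leq_add2r fgsizeV fgsize_fgw //.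
      by case/andP: (x_size i).
    by rewrite fgsize_fgw //; case/andP: (x_size k).
  have [v [rv vE]] := fgw_flanked ab h.
  have -> : ((fgw (y i))^-1 * (g * fgw (z k)))%g = fgw (invw B ++ v ++ A).
    by rewrite -vE /y /z !fgw_cat invgM !mulgA.
  by rewrite -(k1 v rv) /delta; lra.
have my1 : median (fun i => ot_act (fgw (y i)) o1) m1.
  by apply: (median_prolong C_ge0 C1P x_div) => // i; case: (x_long i).
have my2 : median (fun i => ot_act (fgw (y i)) o2) m2.
  by apply: (median_prolong C_ge0 C2P x_div) => // i; case: (x_long i).
have mz1 : median (fun i => ot_act g (ot_act (fgw (z i)) o1)) (ot_act g m1).
  move=> i j ij; apply/btw_act; move: i j ij.
  by apply: (median_prolong C_ge0 C1P x_div) => // i; case: (x_long i).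
have mz2 : median (fun i => ot_act g (ot_act (fgw (z i)) o2)) (ot_act g m2).
  move=> i j ij; apply/btw_act; move: i j ij.
  by apply: (median_prolong C_ge0 C2P x_div) => // i; case: (x_long i).
have step k : mdist m1 (ot_act g (ot_act (fgw (z k)) o1)) =
    mdist m2 (ot_act g (ot_act (fgw (z k)) o2)) + al / 2.
  rewrite metric_sym [in RHS]metric_sym.
  apply: (median_dist (ot_real_tree T1) (ot_real_tree T2) my1 my2) => i j ij.
  by rewrite /median_term !gzy yd //; lra.
rewrite -[RHS]addr0;
  apply: (median_dist (ot_real_tree T1) (ot_real_tree T2) mz1 mz2).
by move=> i j ij; rewrite /median_term !step !ot_isometric zd //; lra.
Qed.

End BoundedRigid.

(** * A criterion for spectral rigidity *)

Section RigidityCriterion.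
Variables (R : realType) (N : nat) (N_ge2 : (2 <= N)%N).
Local Notation word := (seq (letter N)).
Implicit Types (u v w r : word).

Lemma displ_from_spectrum (T : outer_tree R N) (o : T) (L : nat) :
  exists K : R, forall v w r r', (size r <= L)%N -> (size r' <= L)%N ->
    let w' := w ++ r ++ v ++ r' in
    reduced (w ++ w) -> reduced (w' ++ w') ->
    `|displ o (fgw v) - (length_spectrum T (conj_class (fgw w')) -
                         length_spectrum T (conj_class (fgw w)))| <= K.
Proof.
have [C C_ge0 CP] := displ_cat N_ge2 o.
have M0 := displ_letter_ge0 o; pose M := displ_letter o.
exists (2 * C + 2 * (M * L%:R)) => v w r r' rL rL' w' rw rw'.
have rw1 := reduced_catl rw'.
have short u : reduced u -> (size u <= L)%N -> displ o (fgw u) <= M * L%:R.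
  move=> ru uL; rewrite (le_trans (displ_fgsize _ _)) // ler_wpM2l //.
  by rewrite fgsize_fgw // ler_nat.
have rr : reduced (r ++ v ++ r') by exact: reduced_catr rw1.
have rvr : reduced (v ++ r') by exact: reduced_catr rr.
have sr := short r (reduced_catl rr) rL; have sr' := short r' (reduced_catr rvr)
  rL'.
have h1 := CP _ _ rw1; have h2 : displ o (fgw w') <= displ o (fgw w) +
  displ o (fgw (r ++ v ++ r')).
  by rewrite /w' fgw_cat displM.
have h3 : displ o (fgw (r ++ v ++ r')) <= displ o (fgw v) + 2 * (M * L%:R).
  rewrite !fgw_cat; have := displM o (fgw r) (fgw v * fgw r')%g.
  by have := displM o (fgw v) (fgw r'); lra.
have h4 : displ o (fgw v) <= displ o (fgw (r ++ v ++ r')) + 2 * (M * L%:R).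
  have := displM o (fgw r)^-1%g (fgw (r ++ v ++ r') * (fgw r')^-1)%g.
  have := displM o (fgw (r ++ v ++ r')) (fgw r')^-1%g.
  by rewrite !displV !fgw_cat !mulgA !mulgK mulVg mul1g; lra.
rewrite !length_spectrum_conj.
have := translation_length_le o (fgw w); have :=
  translation_length_le o (fgw w').
have := translation_length_ge CP rw; have := translation_length_ge CP rw'.
rewrite -/w' in h1 *; rewrite ler_norml; lra.
Qed.

(** The difference of the translation lengths of [w] and of [w r v r'] is the
    displacement by [v] up to a bounded error, so the length spectrum on [E]
    determines the displacement function up to a bounded error. *)
Lemma spectrally_rigid_of_words (E : set (conj_classes (free_group N)))
  (L : nat) :
    (forall v, reduced v -> v != [::] -> exists w r r',
      [/\ (size r <= L)%N /\ (size r' <= L)%N, reduced (w ++ w),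
        reduced ((w ++ r ++ v ++ r') ++ (w ++ r ++ v ++ r')),
        E (conj_class (fgw w)) & E (conj_class (fgw (w ++ r ++ v ++ r')))]) ->
  spectrally_rigid R E.
Proof.
move=> EP T1 T2 ell.
have [[p1 _] _] := ot_real_tree T1; have [[p2 _] _] := ot_real_tree T2.
have [K1 K1P] := displ_from_spectrum p1 L; have [K2 K2P] :=
  displ_from_spectrum p2 L.
apply: (bounded_difference_eq N_ge2 (o1 := p1) (o2 := p2)).
exists (Num.max 0 (K1 + K2)) => v rv; rewrite le_max; apply/orP.
have [->|v0] := eqVneq v [::]; first by left; rewrite /delta fgw0 !displ1 subrr
  normr0.
have [w [r [r' [[rL rL'] rw rw' Ew Ew']]]] := EP v rv v0; right.
have := K1P v w r r' rL rL' rw rw'; have := K2P v w r r' rL rL' rw rw'.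
by rewrite /delta !ell // !ler_norml; lra.
Qed.

End RigidityCriterion.

(** * Cylinders in the boundary *)

Section BasisMetric.
Variable N : nat.
Local Notation F := (free_group N).
Local Notation word := (seq (letter N)).
Implicit Types (x y g : F) (u v w p : word).
Local Notation S0 := (fg_basis N).

Lemma word_length_basis x : word_length S0 x = fgsize x.
Proof.
apply/eqP; rewrite eqn_leq; apply/andP; split; last first.
  have /asboolP[w [<- ww <-]] := word_lengthP (@fg_basis_generates N) x.
  exact: size_fg.
rewrite -{1}(fgw_val x) /fgsize.
rewrite -(size_map (fun a : letter N => fgw [:: a])); apply: word_length_le.
  rewrite /is_word all_map; apply/allP => -[i []] _ /=.
    by rewrite (_ : fgw _ = fg_gen i) ?mem_fg_basis //; exact/val_inj.
  rewrite (_ : fgw _ = (fg_gen i)^-1%g) ?invgK ?mem_fg_basis ?orbT //.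
  exact/val_inj.
rewrite big_map; elim: (val x) => [|a w IHw]; first by rewrite big_nil fgw0.
by rewrite big_cons IHw -fgw_cat.
Qed.

Lemma gromov_product_basis x y c u v :
    val x = c ++ u -> val y = c ++ v -> reduced (invw u ++ v) ->
  gromov_product S0 x y = (size c)%:R.
Proof.
move=> xE yE r; rewrite /gromov_product /word_dist !invg1 !mul1g
  !word_length_basis.
have -> : fgsize x = (size c + size u)%N by rewrite /fgsize xE size_cat.
have -> : fgsize y = (size c + size v)%N by rewrite /fgsize yE size_cat.
rewrite -(fgw_val x) -(fgw_val y) xE yE fgVM_common fgsize_fgw //.
rewrite size_cat size_invw !natrD; lra.
Qed.

Lemma gromov_product_prefix p x y : prefix p (val x) -> prefix p (val y) ->
  (size p)%:R <= gromov_product S0 x y.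
Proof.
move=> /prefixP[s xs] /prefixP[t yt].
have rs : reduced s by apply: (@reduced_catr _ p); rewrite -xs; exact: valP.
have rt : reduced t by apply: (@reduced_catr _ p); rewrite -yt; exact: valP.
have [c [u [v []]]] := common_prefix (fgw s) (fgw t); rewrite !val_fgw // =>
  sE tE r.
rewrite (@gromov_product_basis x y (p ++ c) u v) //.
- by rewrite ler_nat size_cat leq_addr.
- by rewrite xs sE catA.
- by rewrite yt tE catA.
Qed.

Lemma prefix_gromov_product n x y : n%:R <= gromov_product S0 x y ->
  [/\ take n (val x) = take n (val y), (n <= fgsize x)%N & (n <= fgsize y)%N].
Proof.
have [c [u [v [xE yE r]]]] := common_prefix x y.
rewrite (gromov_product_basis xE yE r) ler_nat => nc; rewrite /fgsize xE yE.
by rewrite !takel_cat // !size_cat !(leq_trans nc) ?leq_addr.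
Qed.

End BasisMetric.

Section Cylinders.
Variables (N : nat) (N_ge2 : (2 <= N)%N).
Local Notation F := (free_group N).
Local Notation word := (seq (letter N)).
Local Notation S0 := (fg_basis N).
Local Notation bd := (boundary N_ge2).
Implicit Types (x y g : F) (u v w p : word) (xi eta : bd) (s t : nat -> F).

Lemma converges_common (s t : nat -> F) (xi : bd) n : converges_to s xi ->
  converges_to t xi ->
  exists m, forall i j, (m <= i)%N -> (m <= j)%N ->
    [/\ take n (val (s i)) = take n (val (t j)), (n <= fgsize (s i))%N &
        (n <= fgsize (t j))%N].
Proof.
rewrite /converges_to; have [r rr ->] := boundary_classP xi => -[ss rs] [tt rt].
have [m1 m1P] := rs n%:R; have [m2 m2P] := rt n%:R.
pose m := maxn m1 m2; exists m => i j mi mj.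
have h1 := m1P m i (leq_maxl _ _) (leq_trans (leq_maxl _ _) mi).
have h2 := m2P m j (leq_maxr _ _) (leq_trans (leq_maxr _ _) mj).
have [e1 _ l1] := prefix_gromov_product h1; have [e2 _ l2] :=
  prefix_gromov_product h2.
by split; rewrite // -e1 e2.
Qed.

Lemma converges_ex (xi : bd) : exists s, converges_to s xi.
Proof.
have [r rr rE] := boundary_classP xi; exists r; rewrite /converges_to rE.
by split.
Qed.

(** The points of the boundary whose infinite reduced word begins with [u]. *)
Definition cylinder u : set bd :=
  [set xi | exists2 s : nat -> F, converges_to s xi &
  exists m, forall i, (m <= i)%N -> prefix u (val (s i))].

Lemma cylinderP u (xi : bd) (s : nat -> F) : converges_to s xi ->
  cylinder u xi <-> exists m, forall i, (m <= i)%N -> prefix u (val (s i)).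
Proof.
move=> sxi; split; last by exists s.
move=> [t txi [m1 m1P]]; have [m mP] := converges_common (size u) txi sxi.
exists (maxn m m1) => i; rewrite geq_max => /andP[mi m1i].
have [e l1 l2] := mP i i mi mi; have := m1P i m1i.
by rewrite !prefixE e.
Qed.

Lemma cylinder_catl u v : cylinder (u ++ v) `<=` cylinder u.
Proof.
move=> xi [s sxi [m mP]]; exists s => //; exists m => i /mP.
exact: catl_prefix.
Qed.

Lemma cylinder_inj u v (xi : bd) : cylinder u xi -> cylinder v xi -> size u =
  size v -> u = v.
Proof.
move=> [s sxi sP] /(cylinderP _ sxi)[m2 m2P] uv; have [m1 m1P] := sP.
have := m1P _ (leq_maxl m1 m2); have := m2P _ (leq_maxr m1 m2).
by rewrite !prefixE uv => /eqP -> /eqP.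
Qed.

Lemma cylinder_ex n (xi : bd) : exists u,
  [/\ size u = n, reduced u & cylinder u xi].
Proof.
have [s sxi] := converges_ex xi; have [m mP] := converges_common n sxi sxi.
exists (take n (val (s m))); have [_ l1 _] := mP m m (leqnn _) (leqnn _).
split; first exact: size_takel.
  by apply: (@reduced_catl _ _ (drop n (val (s m)))); rewrite cat_take_drop;
    exact: valP.
exists s => //; exists m => i mi; have [e _ _] := mP m i (leqnn _) mi.
by rewrite e prefix_take.
Qed.

Lemma cylinder_take u n xi : cylinder u xi -> cylinder (take n u) xi.
Proof. by rewrite -{1}(cat_take_drop n u); exact: cylinder_catl. Qed.

Lemma cylinder_prefix u v (xi : bd) : cylinder u xi -> cylinder v xi ->
  (size u <= size v)%N -> take (size u) v = u.
Proof.
move=> uxi /(cylinder_take (size u))/cylinder_inj h uv.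
by apply: h uxi _; rewrite size_takel.
Qed.

Lemma cylinder_reduced u (xi : bd) : cylinder u xi -> reduced u.
Proof.
by move=> uxi; have [v [vu rv vxi]] := cylinder_ex (size u) xi;
  rewrite (cylinder_inj uxi vxi).
Qed.

Lemma cylinder_open u : open (cylinder u).
Proof.
rewrite [open _]/(boundary_open _) => xi uxi; exists (size u)%:R => eta.
move=> [s [t [sxi teta [n nP]]]].
have /(cylinderP _ sxi)[m mP] := uxi; exists t => //; exists n => i ni.
have := nP _ _ (leq_maxl n m) ni => /prefix_gromov_product[e l1 l2].
by have := mP _ (leq_maxr n m); rewrite !prefixE e.
Qed.

Lemma cylinder_measurable u : measurable (cylinder u).
Proof. by apply: sub_sigma_algebra; exact: cylinder_open. Qed.

Lemma converges_bact g (s : nat -> F) (xi : bd) : converges_to s xi ->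
  converges_to (fun n => g * s n)%g (bact g xi).
Proof. by move=> sxi; exists s. Qed.

(** If [u p] is reduced then translation by [u] is prefixing by [u]. *)
Lemma bact_cylinder u p : reduced (u ++ p) -> p != [::] ->
  bact (fgw u)^-1%g @^-1` cylinder p = cylinder (u ++ p).
Proof.
move=> rup p0; apply/seteqP; split=> xi; have [s sxi] := converges_ex xi.
  move=> /(cylinderP _ (converges_bact _ sxi))[m mP]; apply/(cylinderP _ sxi).
  exists m => i /mP /prefixP[w wE].
  rewrite -(mulVKg (fgw u) (s i)) -(fgw_val ((fgw u)^-1 * s i)%g) wE -fgw_cat
    val_fgw.
    by rewrite catA prefix_prefix.
  by apply: reduced_cat3 => //; rewrite -wE; exact: valP.
move=> /(cylinderP _ sxi)[m mP]; apply/(cylinderP _ (converges_bact _ sxi)).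
exists m => i /mP /prefixP[w wE].
rewrite -(fgw_val (s i)) wE -catA fgw_cat mulKg val_fgw ?prefix_prefix //.
by apply: (@reduced_catr _ u); rewrite catA -wE; exact: valP.
Qed.

Lemma converges_prefixes (xi : bd) (x : nat -> F) :
    (forall k, cylinder (val (x k)) xi) ->
    (forall n, exists m, forall k, (m <= k)%N -> (n <= fgsize (x k))%N) ->
  converges_to x xi.
Proof.
move=> xxi xoo; have [s sxi] := converges_ex xi.
have pre n : exists u m, [/\ size u = n, forall k, (m <= k)%N ->
  prefix u (val (x k)) &
    forall k, (m <= k)%N -> prefix u (val (s k))].
  have [u [un _ uxi]] := cylinder_ex n xi; have [m1 m1P] := xoo n.
  have [m2 m2P] := (cylinderP u sxi).1 uxi.
  exists u, (maxn m1 m2); split=> // k; rewrite geq_max => /andP[k1 k2];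
    last exact: m2P.
  by rewrite prefixE (cylinder_prefix uxi (xxi k)) ?un //; exact: m1P.
have bound (M : rat) : exists n : nat, M <= n%:R.
  exists (Num.truncn `|M|).+1; rewrite (le_trans (ler_norm M)) //.
  by rewrite ltW // truncnS_gt.
move: sxi; rewrite /converges_to; have [r rr ->] := boundary_classP xi =>
  -[ss rs].
split=> M; have [n /le_trans Mn] := bound M; have [u [m [un ux us]]] := pre n.
  by exists m => i j mi mj; apply: Mn; rewrite -un;
    apply: gromov_product_prefix; exact: ux.
have [m1 m1P] := rs n%:R.
exists (maxn m m1) => i j; rewrite !geq_max => /andP[mi m1i] /andP[mj m1j].
apply: Mn; rewrite -un; apply: gromov_product_prefix; last exact: ux.
have [e _ _] := prefix_gromov_product (m1P i (maxn m m1) m1i (leq_maxr _ _)).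
by have := us _ (leq_maxl m m1); rewrite !prefixE un e.
Qed.

End Cylinders.

(** * The shadow lemma *)

Lemma limn_esup_between (R : realType) (f : nat -> \bar R) (a b : \bar R) :
    (exists m, forall i, (m <= i)%N -> (a <= f i <= b)%E) ->
  (a <= limn_esup f <= b)%E.
Proof.
move=> [m mP]; apply/andP; split.
  apply: le_ereal_inf_tmp => _ [V [k _ kV] <-].
  have := mP _ (leq_maxl m k) => /andP[am _]; apply: le_trans am _.
  by apply: ereal_sup_ubound; exists (maxn m k) => //; apply: kV;
    exact: leq_maxr.
apply: (@le_trans _ _ (ereal_sup (f @` [set i | (m <= i)%N]))).
  by apply: ereal_inf_lbound; exists [set i | (m <= i)%N] => //; exists m.
by apply: ge_ereal_sup => _ [i mi <-]; case/andP: (mP i mi).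
Qed.

Lemma ae_bounded_integral d (T : measurableType d) (R : realType)
    (mu : {measure set T -> \bar R}) (A : set T) (f : T -> \bar R) (a b : R) :
    measurable A -> measurable_fun A f -> 0 <= a -> a <= b ->
    {ae mu, forall x, A x -> (a%:E <= f x <= b%:E)%E} ->
  (a%:E * mu A <= \int[mu]_(x in A) f x <= b%:E * mu A)%E.
Proof.
move=> mA mf a0 ab fab.
(* The bounds hold everywhere for the truncated function. *)
pose g x := maxe (mine (f x) b%:E) a%:E.
have mg : measurable_fun A g by apply: measurable_maxe => //;
  exact: measurable_mine.
have ga x : (a%:E <= g x)%E by rewrite le_max lexx orbT.
have gb x : (g x <= b%:E)%E by rewrite ge_max ge_min lexx orbT lee_fin.
have -> : (\int[mu]_(x in A) f x = \int[mu]_(x in A) g x)%E.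
  apply: ae_eq_integral => //; apply: filterS fab => x fx Ax.
  have /andP[fa fb] := fx Ax; rewrite /g.
  by rewrite (min_idPl fb) (max_idPl fa).
rewrite -(integral_cst mu mA) -(integral_cst mu mA); apply/andP; split.
  by apply: ge0_le_integral => // x _; rewrite lee_fin.
apply: ge0_le_integral => // x _; apply: le_trans (ga x); by rewrite lee_fin.
Qed.

Section PattersonSullivanCylinders.
Variables (R : realType) (N : nat) (N_ge2 : (2 <= N)%N).
Variables (S : {fset free_group N}) (genS : generates S).
Local Notation word := (seq (letter N)).
Local Notation bd := (boundary N_ge2).
Local Notation wl := (word_length S).
Implicit Types (u v w p q : word) (xi eta : bd).

Variable K : nat.
Hypothesis KP : forall u v, reduced (u ++ v) ->
  (wl (fgw u) + wl (fgw v) <= wl (fgw (u ++ v)) + K)%N.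

(** The Busemann function of [u^-1] is nearly constant on the cylinder of [p]
    if [u p] is reduced: a geodesic from [u^-1] to the far end passes near
    1. *)
Lemma busemann_cylinder u p (xi : bd) : reduced (u ++ p) -> p != [::] ->
  cylinder p xi ->
  (wl (fgw u))%:R - K%:R <= busemann R S (fgw u)^-1%g xi <= (wl (fgw u))%:R.
Proof.
move=> rup p0 pxi.
set a : R := (wl (fgw u))%:R - K%:R; set b : R := (wl (fgw u))%:R.
pose f (s : nat -> free_group N) := limn_esup (fun n =>
  ((word_dist S (fgw u)^-1%g (s n))%:R - (word_dist S 1%g (s n))%:R)%:E : \bar
    R).
have fab s : converges_to s xi -> (a%:E <= f s <= b%:E)%E.
  move=> sxi; apply: limn_esup_between; have [m mP] := (cylinderP p sxi).1 pxi.
  exists m => i /mP /prefixP[w wE].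
  rewrite !lee_fin /word_dist invgK invg1 mul1g -(fgw_val (s i)) wE.
  have rw : reduced (u ++ (p ++ w)).
    by apply: reduced_cat3 => //; rewrite -wE; exact: valP.
  have := KP rw; have := word_lengthM genS (fgw u) (fgw (p ++ w)).
  rewrite -fgw_cat -(ler_nat R) natrD => h1; rewrite -(ler_nat R) !natrD => h2.
  by rewrite /a /b; apply/andP; split; lra.
have [s0 s0xi] := converges_ex xi.
have : (a%:E <= ereal_sup [set f s | s in [set s | converges_to s xi]] <=
  b%:E)%E.
  have /andP[h1 h2] := fab s0 s0xi; apply/andP; split.
    by apply: le_trans h1 _; apply: ereal_sup_ubound; exists s0.
  by apply: ge_ereal_sup => _ [s sxi <-]; case/andP: (fab s sxi).
by rewrite /busemann -/f; case: (ereal_sup _) => [r| |] //=;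
  rewrite ?leNye ?leye_eq ?leeNy_eq ?andbF.
Qed.

Variable nu : probability bd R.
Hypothesis PSnu : patterson_sullivan S nu.

Definition mass (A : set bd) : R := fine (nu A).

Lemma massE (A : set bd) : measurable A -> nu A = (mass A)%:E.
Proof. by move=> mA; rewrite fineK // fin_num_measure. Qed.

Lemma mass_ge0 A : 0 <= mass A. Proof. exact: fine_ge0. Qed.

Lemma mass_le (A B : set bd) : measurable A -> measurable B -> A `<=` B ->
  mass A <= mass B.
Proof. by move=> mA mB AB; rewrite -lee_fin -!massE // le_measure ?inE. Qed.

Lemma mass_le1 (A : set bd) : measurable A -> mass A <= 1.
Proof. by move=> mA; rewrite -lee_fin -massE // probability_le1. Qed.

(** Sullivan's shadow lemma: the Radon-Nikodym derivative is the exponential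
    of a Busemann function which is nearly constant where [u] does not cancel,
    so that translation by [u] scales the measure by [exp (- v |u|)] up to a
    constant. *)
Lemma shadow_lemma : exists c1 c2 : R, [/\ 0 < c1, 0 < c2 & forall u,
  exists e : R, 0 < e /\
  forall A : set bd, measurable A ->
    (forall xi, A xi -> exists p, [/\ reduced (u ++ p), p != [::] &
      cylinder p xi]) ->
  c1 * e * mass A <= mass (bact (fgw u)^-1%g @^-1` A) <= c2 * e * mass A].
Proof.
have [C C1 CP] := PSnu; have C0 : 0 < C by exact: lt_trans C1.
pose v : R := growth_rate R S; pose k : R := expR (`|v| * K%:R).
have k0 : 0 < k by exact: expR_gt0.
exists (C^-1 * k^-1), (C * k); split; rewrite ?mulr_gt0 ?invr_gt0 //.
move=> u; pose L : R := (wl (fgw u))%:R; exists (expR (- v * L)); split;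
  first exact: expR_gt0.
move=> A mA Acyl; have [ac RN] := CP (fgw u)^-1%g.
have mX : measurable (bact (fgw u)^-1%g @^-1` A).
  by rewrite -[X in measurable X]setTI;
    exact: (bact_measurable _ measurableT mA).
pose mu1 := charge_of_finite_measure
  (distribution nu (bact (N_ge2 := N_ge2) (fgw u)^-1%g)).
have ac1 : mu1 `<< nu by [].
have nuX : nu (bact (fgw u)^-1%g @^-1` A) =
  (\int[nu]_(x in A) Radon_Nikodym mu1 nu x)%E.
  by rewrite -Radon_Nikodym_integral.
have mRN : measurable_fun A (Radon_Nikodym mu1 nu).
  have mT := measurable_int _ (Radon_Nikodym_integrable ac1).
  exact: (measurable_funS measurableT (@subsetT _ A) mT).
have vK (b : R) : L - K%:R <= b <= L ->
    k^-1 * expR (- v * L) <= expR (- v * b) <= k * expR (- v * L).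
  move=> /andP[b1 b2]; rewrite /k -expRN -!expRD !ler_expR.
  have K0 : 0 <= K%:R :> R by [].
  suff : `|v * (L - b)| <= `|v| * K%:R by rewrite ler_norml; lra.
  by rewrite normrM ler_wpM2l // ger0_norm; lra.
have ae_b : {ae nu, forall x, A x -> ((C^-1 * k^-1 * expR (- v * L))%:E <=
  Radon_Nikodym mu1 nu x
    <= (C * k * expR (- v * L))%:E)%E}.
  apply: filterS RN => xi /andP[h1 h2] /Acyl[p [rup p0 pxi]].
  have /vK/andP[h3 h4] := busemann_cylinder rup p0 pxi; apply/andP; split.
    by apply: le_trans h1; rewrite lee_fin -mulrA ler_wpM2l // invr_ge0 ltW.
  by apply: le_trans h2 _; rewrite lee_fin -mulrA ler_wpM2l // ltW.
have k1 : 1 <= k by rewrite -expR0 ler_expR mulr_ge0.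
have Ck1 : 1 <= C * k by rewrite -[leLHS]mulr1 ler_pM // ltW.
rewrite -lee_fin -[X in _ && X]lee_fin !EFinM -(massE mA) -(massE mX) nuX
  -!EFinM.
apply: ae_bounded_integral => //.
  by rewrite !mulr_ge0 ?invr_ge0 ?expR_ge0 // ltW.
rewrite ler_wpM2r ?expR_ge0 // -invfM (le_trans _ Ck1) // invf_le1 //.
exact: lt_le_trans Ck1.
Qed.

End PattersonSullivanCylinders.

(** * Recurrence of finite words *)

Section Recurrence.
Variables (R : realType) (N : nat) (N_ge2 : (2 <= N)%N).
Variables (S : {fset free_group N}) (genS : generates S).
Variables (nu : probability (boundary N_ge2) R)
  (PSnu : patterson_sullivan S nu).
Local Notation word := (seq (letter N)).
Local Notation bd := (boundary N_ge2).
Local Notation mu := (mass nu).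
Local Notation C := (cylinder (N_ge2 := N_ge2)).
Implicit Types (u v w p q : word) (z : letter N).

(** The cylinders of the words of length [m] partition the boundary. *)
Lemma mass_le_cylinders m (A B : set bd) (c : R) : measurable A ->
  measurable B ->
    (forall u, size u = m -> mu (A `&` C u) <= c * mu (B `&` C u)) ->
  mu A <= c * mu B.
Proof.
move=> mA mB AB; pose L := ('I_N * bool)%type.
have sumE (X : set bd) : measurable X -> mu X = \sum_(t : m.-tuple L) mu
  (X `&` C t).
  move=> mX; apply: EFin_inj; rewrite -massE // -sumEFin.
  transitivity (nu (\bigcup_(t in [set` enum {: m.-tuple L}]) (X `&` C t))).
    congr (nu _); apply/seteqP; split=> xi; last by move=> [t _ []].
    move=> Xxi; have [u [um _ uxi]] := cylinder_ex m xi.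
    exists (tcast um (in_tuple (u : seq L))); first by rewrite /= mem_enum.
    by split=> //; rewrite val_tcast.
  rewrite measure_fin_bigcup //.
  - rewrite -fsbig_seq ?enum_uniq // big_enum /=.
    apply: eq_bigr => t _; rewrite massE //.
    by apply: measurableI => //; exact: cylinder_measurable.
  - move=> s t _ _ [xi [[_ sxi] [_ txi]]]; apply/val_inj/(cylinder_inj sxi txi).
    by rewrite !size_tuple.
  - by move=> t _; apply: measurableI => //; exact: cylinder_measurable.
rewrite (sumE A) // (sumE B) // mulr_sumr; apply: ler_sum => t _.
by apply: AB; rewrite size_tuple.
Qed.

(** Some cylinder of a letter has positive mass, and it can be moved into the
    cylinder of [p]. *)
Lemma mass_cylinder_gt0 p : reduced p -> p != [::] -> 0 < mu (C p).
Proof.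
move=> rp p0; have [K KP] := word_length_cat genS.
have [c1 [c2 [c10 c20 sh]]] := shadow_lemma genS KP PSnu.
have [a a0] : exists a : letter N, 0 < mu (C [:: a]).
  apply: contrapT => no; have : mu setT <= 1 * mu set0.
    apply: (@mass_le_cylinders 1) => // -[|a []] // _.
    rewrite setTI set0I {2}/mass measure0 mulr0 leNgt; apply/negP => a0.
    by apply: no; exists a.
  by rewrite /mass measure0 probability_setT /= mulr0 ler10.
have [z] := @fresh_letter N [:: letter_inv (last a p); letter_inv a] N_ge2 isT.
rewrite !inE !negb_or => /andP[zp za].
have rpz : reduced (p ++ [:: z]).
  by apply: reduced_rcons => //; case: p p0 zp {rp} => // b p _.
have rpza : reduced ((p ++ [:: z]) ++ [:: a]).
  rewrite -catA; apply: reduced_cat3 => //; apply/andP; split=> //.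
  by apply: contraNneq za => ->; rewrite letter_invK.
have [e [e0 eP]] := sh (p ++ [:: z]).
have /andP[h _] : c1 * e * mu (C [:: a]) <=
    mu (bact (fgw (p ++ [:: z]))^-1%g @^-1` C [:: a]) <= c2 * e * mu (C [:: a]).
  apply: eP; first exact: cylinder_measurable.
  by move=> xi axi; exists [:: a].
rewrite bact_cylinder // in h.
apply: lt_le_trans (_ : mu (C ((p ++ [:: z]) ++ [:: a])) <= _).
  by apply: lt_le_trans h; rewrite !mulr_gt0.
apply: mass_le; [exact: cylinder_measurable|exact: cylinder_measurable|].
by rewrite -catA; exact: cylinder_catl.
Qed.

(** By the shadow lemma the proportion of the cylinder of [u] which continues
    with [z q] is that of the cylinder of [z q] in the whole boundary, up to a
    constant independent of [u]. *)
Lemma cylinder_continue q : reduced q -> q != [::] ->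
  exists delta : R, [/\ 0 < delta, delta <= 1 & forall u, reduced u ->
    u != [::] ->
    exists z, delta * mu (C u) <= mu (C (u ++ z :: q))].
Proof.
move=> rq q0; have [K KP] := word_length_cat genS.
have [c1 [c2 [c10 c20 sh]]] := shadow_lemma genS KP PSnu.
have [d0 [d00 d0P]] : exists d0 : R, 0 < d0 /\
    forall z, reduced (z :: q) -> d0 <= mu (C (z :: q)).
  have hz (z : 'I_N * bool) : \forall d \near (0 : R)^'+,
      reduced (z :: q) -> d <= mu (C (z :: q)).
    have [rz|_] := boolP (reduced (z :: q)); last by near=> d.
    have := nbhs_right_le (mass_cylinder_gt0 rz isT); by apply: filterS.
  have hp := filterI (nbhs_right_gt (0 : R)) (filter_forall _ hz).
  by have [d [d0 dP]] := @filter_ex _ _ _ _ (hp _ _); exists d.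
pose delta := Num.min 1 (c1 * d0 / c2).
exists delta; split; first by rewrite lt_min ltr01 divr_gt0 ?mulr_gt0.
  by rewrite ge_min lexx.
move=> u ru u0; pose a0 := head (Ordinal N_ge2, true) q.
have [z] := @fresh_letter N [:: letter_inv (last a0 u); letter_inv a0] N_ge2
  isT.
rewrite !inE !negb_or => /andP[zu za]; exists z.
have rzq : reduced (z :: q).
  case: q rq q0 {d0P} @a0 zu za => // b q rq _ /= zu za; apply/andP; split=> //.
  by apply: contraNneq za => ->; rewrite letter_invK.
have ruz : reduced (u ++ [:: z]).
  by apply: reduced_rcons => //; case: u u0 zu {ru} => // b u _.
have ruzq : reduced (u ++ z :: q) by exact: (@reduced_cat3 _ u [:: z] q).
have [e [e0 ePP]] := sh u.
have h1 : c1 * e * d0 <= mu (C (u ++ z :: q)).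
  have /andP[h _] : c1 * e * mu (C (z :: q)) <=
      mu (bact (fgw u)^-1%g @^-1` C (z :: q)) <= c2 * e * mu (C (z :: q)).
    apply: ePP; first exact: cylinder_measurable.
    by move=> xi zxi; exists (z :: q).
  rewrite bact_cylinder // in h.
  by apply: le_trans h; rewrite ler_wpM2l ?d0P // mulr_ge0 ?ltW.
have h2 : mu (C u) <= c2 * e.
  pose A := \bigcup_(b in [set b : letter N | reduced (u ++ [:: b])]) C [:: b].
  have mA : measurable A.
    by apply: sub_sigma_algebra; apply: bigcup_open => b _;
      exact: cylinder_open.
  have /andP[_ h] : c1 * e * mu A <= mu (bact (fgw u)^-1%g @^-1` A) <=
    c2 * e * mu A.
    by apply: ePP => // xi [b rub bxi]; exists [:: b].
  apply: (@le_trans _ _ (mu (bact (fgw u)^-1%g @^-1` A))).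
    apply: mass_le; first exact: cylinder_measurable.
      by rewrite -[X in measurable X]setTI;
        exact: (bact_measurable _ measurableT mA).
    move=> xi uxi; have [w [wu rw wxi]] := cylinder_ex (size u).+1 xi.
    have uE : u = take (size u) w.
      by rewrite (cylinder_prefix uxi wxi) // wu.
    have [b bE] : exists b, drop (size u) w = [:: b].
      have : size (drop (size u) w) = 1%N by rewrite size_drop wu subSnn.
      by case: (drop _ _) => [|b []] // _; exists b.
    have wE : w = u ++ [:: b] by rewrite -bE {1}uE cat_take_drop.
    exists b; first by rewrite /= -wE.
    have : C (u ++ [:: b]) xi by rewrite -wE.
    by rewrite -bact_cylinder // -wE.
  apply: le_trans h _; rewrite -[leRHS]mulr1 ler_wpM2l ?mass_le1 // mulr_ge0
    ?ltW //.
apply: le_trans h1; apply: (@le_trans _ _ (c1 * d0 / c2 * (c2 * e))).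
  apply: ler_pM; rewrite ?mass_ge0 // ?ge_min ?lexx ?orbT //.
  by rewrite le_min ler01 divr_ge0 ?mulr_ge0 ?ltW.
by rewrite mulrA divfK ?gt_eqF // mulrAC.
Unshelve. all: by end_near. Qed.

End Recurrence.

Section PatternsRecur.
Variables (R : realType) (N : nat) (N_ge2 : (2 <= N)%N).
Variables (S : {fset free_group N}) (genS : generates S).
Variables (nu : probability (boundary N_ge2) R)
  (PSnu : patterson_sullivan S nu).
Local Notation word := (seq (letter N)).
Local Notation bd := (boundary N_ge2).
Local Notation mu := (mass nu).
Local Notation C := (cylinder (N_ge2 := N_ge2)).
Implicit Types (u v w p q : word) (z : letter N).

(** The letter [z] is there to join an arbitrary [u] to [q] without
    cancellation. *)
Definition occurs q m : set bd :=
  [set xi | exists u z, size u = m /\ C (u ++ z :: q) xi].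

Lemma occurs_measurable q m : measurable (occurs q m).
Proof.
have -> : occurs q m = \bigcup_(u in [set u | size u = m]) \bigcup_z C
  (u ++ z :: q).
  apply/seteqP; split=> xi; first by move=> [u [z [um uz]]]; exists u => //;
    exists z.
  by move=> [u um [z _ uz]]; exists u, z.
apply: sub_sigma_algebra; apply: bigcup_open => u _; apply: bigcup_open => z _.
exact: cylinder_open.
Qed.

(** In each of the successive blocks of [(size q).+1] letters after the first
    [n], a proportion [delta] of the measure that has not met [q] meets it. *)
Lemma occurs_negligible q n : reduced q -> q != [::] -> (0 < n)%N ->
  nu.-negligible [set xi | forall m, (n <= m)%N -> ~ occurs q m xi].
Proof.
move=> rq q0 n0; have [delta [d0 d1 dP]] := cylinder_continue genS PSnu rq q0.
pose l := (size q).+1.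
pose Bad k : set bd := [set xi | forall j, (j < k)%N ->
  ~ occurs q (n + j * l) xi].
have mC u : measurable (C u) by exact: cylinder_measurable.
have BadS k : Bad k.+1 = Bad k `&` ~` occurs q (n + k * l).
  apply/seteqP; split=> xi; first by move=> B; split=> [j jk|]; apply: B;
    rewrite // ltnS ltnW.
  by move=> [B Bk] j; rewrite ltnS leq_eqVlt => /predU1P[->|/B].
have mBad k : measurable (Bad k).
  elim: k => [|k IHk]; first by rewrite (_ : Bad 0%N = setT) //; apply/seteqP;
    split.
  by rewrite BadS; apply: measurableI => //; apply: measurableC;
    exact: occurs_measurable.
have step k : mu (Bad k.+1) <= (1 - delta) * mu (Bad k).
  apply: (@mass_le_cylinders _ _ _ _ (n + k * l)) => // u um.
  have [[xi0 [Bxi uxi]]|no] := pselect (exists xi0, (Bad k `&` C u) xi0);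
    last first.
    have -> : Bad k.+1 `&` C u = set0.
      apply/seteqP; split=> // xi [+ uxi]; rewrite BadS => -[Bxi _].
      by apply: no; exists xi.
    by rewrite {1}/mass measure0 mulr_ge0 ?mass_ge0 // subr_ge0.
  have ru := cylinder_reduced uxi.
  have [|z zP] := dP u ru; first by rewrite -size_eq0 um; lia.
  have -> : Bad k `&` C u = C u.
    apply/setIidPr => eta ueta j jk [v [z' [vm vz]]]; apply: (Bxi j jk).
    exists v, z'; split=> //.
    have le_sz : (size (v ++ z' :: q) <= size u)%N.
      by rewrite size_cat vm um -addnA leq_add2l addnC -/l -mulSn leq_mul2r jk
        orbT.
    by rewrite -(cylinder_prefix vz ueta le_sz); exact: cylinder_take.
  pose X := Bad k.+1 `&` C u.
  have mX : measurable X by exact: measurableI.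
  have XY : mu X + mu (C (u ++ z :: q)) <= mu (C u).
    rewrite -lee_fin EFinD -!(massE nu) // -measureU //.
      apply: le_measure; rewrite ?inE //; first exact: measurableU.
      by move=> xi [[]|/cylinder_catl].
    apply/seteqP; split=> // xi [[+ _] uz]; rewrite BadS => -[_]; apply.
    by exists u, z.
  by rewrite mulrBl mul1r lerBrDr (le_trans _ XY) // lerD2l.
have bnd k : mu (Bad k) <= (1 - delta) ^+ k.
  elim: k => [|k IHk]; first by rewrite expr0 mass_le1.
  by rewrite exprS (le_trans (step k)) // ler_wpM2l // subr_ge0.
pose Never : set bd := [set xi | forall m, (n <= m)%N -> ~ occurs q m xi].
have mNever : measurable Never.
  have -> : Never = \bigcap_(m in [set m | (n <= m)%N]) ~` occurs q m.
    by apply/seteqP; split.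
  by apply: bigcap_measurable; [exists n => /=|move=> m _; apply: measurableC;
    exact: occurs_measurable].
exists Never; split=> //; apply: (eq_trans (massE nu mNever)).
suff : mu Never <= 0 by move=> h; congr EFin; apply/eqP;
  rewrite eq_le h mass_ge0.
have ek : (fun k => (1 - delta) ^+ k : R) @ \oo --> (0 : R).
  by apply: cvg_expr; rewrite ltr_norml; apply/andP; split; move: d0 d1; lra.
rewrite -(cvg_lim _ ek) //; apply: limr_ge; first by apply/cvg_ex; exists 0.
near=> k; apply: le_trans (bnd k); apply: mass_le => // xi B j _.
by apply: B; rewrite leq_addr.
Unshelve. all: by end_near. Qed.

Lemma words_recur : {ae nu, forall xi, forall q, reduced q -> q != [::] ->
  forall n, exists2 u, (n <= size u)%N & C (u ++ q) xi}.
Proof.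
have H : {ae nu, forall xi, forall k n : nat, forall q : seq ('I_N * bool),
    choice.unpickle k = Some q -> reduced q -> q != [::] ->
    exists2 m, (n < m)%N & occurs q m xi}.
  apply: ae_foralln => k; apply: ae_foralln => n.
  case: (choice.unpickle k) => [q|]; last by apply: aeW.
  have [rq|nrq] := boolP (reduced q); last first.
    by apply: aeW => xi _ [<-] rq; rewrite rq in nrq.
  have [q0|q0] := eqVneq q [::]; first by apply: aeW => xi _ [<-] _; rewrite q0.
  apply: negligibleS (@occurs_negligible q n.+1 rq q0 isT) => xi /= no m nm om.
  by apply: no => _ [<-] _ _; exists m.
apply: filterS H => xi H q rq q0 n.
have [m nm [u [z [um uz]]]] := H (choice.pickle (q : seq ('I_N * bool))) n q
  (choice.pickleK _) rq q0.
exists (u ++ [:: z]); last by rewrite -catA.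
by rewrite size_cat um addn1 ltnW // ltnW.
Qed.

End PatternsRecur.

(** * The ray and its sparse subsequences *)

(** Choice of a sparse subsequence: the tasks [v : X] are each fulfilled by a
    pair of indices which can be taken as large as desired, so that the tasks
    can be carried out one after the other, as late as the growth of [f]
    demands. *)
Section SparseSubsequence.
Variables (R : realType) (X : countType) (x0 : X).
Variables (P : X -> nat -> nat -> Prop) (ell : nat -> R) (K : nat).
Hypothesis PX : forall v b, exists k k',
  [/\ (b <= k)%N, (k < k')%N, P v k k', k%:R - K%:R <= ell k & k'%:R - K%:R <=
    ell k'].

Lemma sparse_subsequence (f : R -> R) : f T @[T --> +oo] --> +oo ->
  exists n : nat -> nat, [/\ forall i j, (i < j)%N -> (n i < n j)%N,
    forall v, exists i j, [/\ (1 <= i)%N, (1 <= j)%N & P v (n i) (n j)] &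
    forall i T, (1 <= i)%N -> ell (n i) < T -> i%:R <= f T].
Proof.
move=> foo; have /choice[th thP] (i : nat) : exists t : nat, forall T, t%:R <=
  T -> i%:R <= f T.
  have [M [_ MP]] := (cvgryPge f).1 foo i%:R.
  exists (Num.truncn `|M|).+1 => T MT; apply: MP; apply: lt_le_trans MT.
  by apply: le_lt_trans (ler_norm M) _; rewrite truncnS_gt.
pose task j := if choice.unpickle j is Some v then v else x0.
have /choice[pr prP] (jb : nat * nat) : exists kk : nat * nat,
    [/\ (jb.2 <= kk.1)%N, (kk.1 < kk.2)%N, P (task jb.1) kk.1 kk.2,
        kk.1%:R - K%:R <= ell kk.1 & kk.2%:R - K%:R <= ell kk.2].
  by have [k [k' h]] := PX (task jb.1) jb.2; exists (k, k').
(* The values of [n] at [2 j + 1] and [2 j + 2] fulfil task [j]. *)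
pose late j b := maxn b.+1 (maxn (th j.*2.+1) (th j.*2.+2) + K).
pose fix pairs j := pr (j, late j (if j is j'.+1 then (pairs j').2 else 0%N)).
have pairsP j : [/\ ((if j is j'.+1 then (pairs j').2 else 0) < (pairs j).1)%N,
    ((pairs j).1 < (pairs j).2)%N, P (task j) (pairs j).1 (pairs j).2,
    (th j.*2.+1)%:R <= ell (pairs j).1 & (th j.*2.+2)%:R <= ell (pairs j).2].
  have -> : pairs j = pr (j, late j (if j is j'.+1 then (pairs j').2 else 0%N)).
    by case: j.
  set b := if j is _.+1 then _ else _; have [/= h1 h2 h3 h4 h5] :=
    prP (j, late j b).
  move: h1; rewrite /late geq_max => /andP[h1 h6].
  have t1 : (th j.*2.+1 + K <= (pr (j, late j b)).1)%N.
    by apply: leq_trans h6; rewrite leq_add2r leq_maxl.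
  have t2 : (th j.*2.+2 + K <= (pr (j, late j b)).2)%N.
    by apply: leq_trans (ltnW h2); apply: leq_trans h6;
      rewrite leq_add2r leq_maxr.
  split=> //; [apply: le_trans h4|apply: le_trans h5].
    by rewrite lerBrDr -natrD ler_nat.
  by rewrite lerBrDr -natrD ler_nat.
pose n i := if i is i'.+1 then if odd i' then (pairs i'./2).2 else
  (pairs i'./2).1
            else 0%N.
have nS i : (n i < n i.+1)%N.
  case: i => [|i] /=; first by have [] := pairsP 0%N.
  rewrite uphalfE; case: ifPn => oi /=.
    have [h _ _ _ _] := pairsP i./2.+1.
    by rewrite (_ : uphalf i = i./2.+1) // uphalf_half oi.
  rewrite (_ : uphalf i = i./2); last by rewrite uphalf_half (negbTE oi).
  by have [] := pairsP i./2.
have nell i : (th i.+1)%:R <= ell (n i.+1).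
  have [_ _ _ h1 h2] := pairsP i./2.
  rewrite /n -{1}(odd_double_half i); case: ifPn => oi.
    by rewrite add1n.
  by rewrite add0n.
exists n; split.
- exact: (homo_ltn ltn_trans nS).
- move=> v; pose j := choice.pickle v; exists j.*2.+1, j.*2.+2; split=> //.
  have [_ _ h _ _] := pairsP j; move: h.
  by rewrite /task choice.pickleK /n /= odd_double /= uphalf_double doubleK.
- move=> [//|i] T _ lt; apply: thP; apply: le_trans (nell i) (ltW lt).
Qed.

End SparseSubsequence.

Section Ray.
Variables (N : nat) (N_ge2 : (2 <= N)%N).
Variables (S : {fset free_group N}) (genS : generates S).
Local Notation word := (seq (letter N)).
Local Notation wl := (word_length S).
Implicit Types (u v w p q r : word).

Variables (M K : nat).
Hypothesis MP : forall x, (wl x <= M * fgsize x)%N.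
Hypothesis KP : forall u v, reduced (u ++ v) ->
  (wl (fgw u) + wl (fgw v) <= wl (fgw (u ++ v)) + K)%N.

Variable xi : boundary N_ge2.

(** A geodesic ray of the tree of reduced words, slowed down so that it is
    parametrized by the word length for [S] up to a bounded error. *)
Lemma rough_ray : exists (W : nat -> word) (tau : nat -> nat),
  [/\ forall n, [/\ size (W n) = n, reduced (W n) & cylinder (W n) xi],
      tau 0%N = 0%N,
      {homo tau : i j / (i <= j)%N},
      forall k, (k <= wl (fgw (W (tau k))) <= k + M)%N &
      forall n, exists k, (n < tau k <= n + (max_gen_size S * K).+1)%N].
Proof.
have /choice[W WP] n := cylinder_ex n xi.
pose f n := wl (fgw (W n)).
have Wcat m n : (m <= n)%N -> W n = W m ++ drop m (W n).
  move=> mn; have [sm _ cm] := WP m; have [sn _ cn] := WP n.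
  by have := cylinder_prefix cm cn; rewrite sm sn => /(_ mn) {1}<-;
    rewrite cat_take_drop.
have Wred m n : (m <= n)%N -> reduced (W m ++ drop m (W n)).
  by move=> /Wcat <-; have [] := WP n.
have szf n : (n <= max_gen_size S * f n)%N.
  have [sn rn _] := WP n; rewrite -{1}sn -(fgsize_fgw rn).
  exact: fgsize_word_length.
have fge k : exists n, (k <= f n)%N.
  exists (max_gen_size S * k).+1; have := szf (max_gen_size S * k).+1.
  by rewrite ltn_mul2l => /andP[_ /ltnW].
(* The first prefix of length at least [k] for [S]. *)
pose tau k := ex_minn (fge k).
have tauP k : (k <= f (tau k))%N by rewrite /tau; case: ex_minnP.
have tau_min k n : (k <= f n)%N -> (tau k <= n)%N.
  by rewrite /tau; case: ex_minnP => m _ mP; exact: mP.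
have f0 : f 0%N = 0%N.
  by have [/size0nil s0 _ _] := WP 0%N; rewrite /f s0 fgw0 word_length1.
exists W, tau; split=> //.
- by apply/eqP; rewrite -leqn0; apply: tau_min.
- by move=> i j ij; apply: tau_min; apply: leq_trans ij (tauP j).
- move=> k; rewrite tauP /=; case E : (tau k) => [|n];
  first by rewrite -/(f 0%N) f0.
  have fn : (f n < k)%N by rewrite ltnNge; apply/negP => /tau_min;
    rewrite E ltnn.
  rewrite (Wcat n n.+1) // fgw_cat (leq_trans (word_lengthM genS _ _)) //.
  rewrite leq_add // ?(ltnW fn) // (leq_trans (MP _)) //.
  have [sn rn _] := WP n.+1.
  rewrite fgsize_fgw ?size_drop ?sn ?subSnn ?muln1 //.
  exact: reduced_catr (Wred n n.+1 (leqnSn n)).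
move=> n; pose L := (max_gen_size S * K).+1; exists (f (n + L)%N).
rewrite tau_min // andbT ltnNge; apply/negP => tn.
set t := tau _ in tn; have tnL : (t <= n + L)%N by rewrite (leq_trans tn)
  ?leq_addr.
have := KP (Wred _ _ tnL); rewrite -(Wcat _ _ tnL).
have ft : (f (n + L) <= f t)%N by exact: tauP.
have rd := reduced_catr (Wred _ _ tnL).
have := fgsize_word_length genS (fgw (drop t (W (n + L)%N))).
have [sn _ _] := WP (n + L)%N.
rewrite fgsize_fgw // size_drop sn -/(f t) -/(f (n + L)%N) => h1 h2.
have h3 : (wl (fgw (drop t (W (n + L)%N))) <= K)%N by move: h2 ft; lia.
have h4 : (L <= max_gen_size S * K)%N.
  apply: (leq_trans _ (leq_trans h1 _)); last by rewrite leq_mul2l h3 orbT.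
  by rewrite -addnBAC // leq_addl.
by rewrite ltnn in h4.
Qed.

End Ray.

Section LongPatterns.
Variables (R : realType) (N : nat) (N_ge2 : (2 <= N)%N).
Variables (S : {fset free_group N}) (genS : generates S).
Local Notation word := (seq (letter N)).
Local Notation wl := (word_length S).
Implicit Types (u v w p q r : word).

(** The displacements of [x k] and [x k'] then differ by that of [v], up to a
    bounded amount, and so do their translation lengths. *)
Definition differ_by (L : nat) (x : nat -> free_group N) v (k k' : nat) : Prop
  :=
  exists w r r', [/\ (size r <= L)%N /\ (size r' <= L)%N, reduced (w ++ w),
    reduced ((w ++ r ++ v ++ r') ++ (w ++ r ++ v ++ r')),
    x k = fgw w & x k' = fgw (w ++ r ++ v ++ r')].

Lemma differ_by_rigid L (x : nat -> free_group N) (A : set nat) :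
    (forall v, reduced v -> v != [::] -> exists k k',
      [/\ A k, A k' & differ_by L x v k k']) ->
  spectrally_rigid R [set conj_class (x k) | k in A].
Proof.
move=> AP; apply: (spectrally_rigid_of_words N_ge2 (L := L)) => v rv v0.
have [k [k' [Ak Ak' [w [r [r' [rr ww ww' xk xk']]]]]]] := AP v rv v0.
by exists w, r, r'; split=> //; [exists k; rewrite ?xk|exists k'; rewrite ?xk'].
Qed.

Variables (M K : nat).
Hypothesis KP : forall u v, reduced (u ++ v) ->
  (wl (fgw u) + wl (fgw v) <= wl (fgw (u ++ v)) + K)%N.
Let L := (max_gen_size S * K).+1.
Variables (xi : boundary N_ge2) (W : nat -> word) (tau : nat -> nat).
Hypothesis WP : forall n, [/\ size (W n) = n, reduced (W n) & cylinder (W n)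
  xi].
Hypothesis tau_homo : {homo tau : i j / (i <= j)%N}.
Hypothesis tau_wl : forall k, (k <= wl (fgw (W (tau k))) <= k + M)%N.
Hypothesis tau_dense : forall n, exists k, (n < tau k <= n + L)%N.
Hypothesis recur : forall q, reduced q -> q != [::] ->
  forall n, exists2 u, (n <= size u)%N & cylinder (u ++ q) xi.

(** The ray passes through [c^L v c^L] for a letter [c] which cancels neither
    against [v] nor against the beginning of the ray, and each block [c^L] is
    long enough to contain a point of the ray. *)
Lemma ray_differ_by v b : reduced v -> v != [::] -> exists k k',
  [/\ (b <= k)%N, (k < k')%N, differ_by L (fun k => fgw (W (tau k))) v k k',
      k%:R - K%:R <= stable_length R S (conj_class (fgw (W (tau k)))) &
      k'%:R - K%:R <= stable_length R S (conj_class (fgw (W (tau k'))))].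
Proof.
move=> rv v0; pose a0 : letter N := (Ordinal N_ge2, true).
pose a := head a0 (W 1%N).
have [c] := @fresh_letter N [:: letter_inv a; letter_inv (head a0 v);
  letter_inv (last a0 v)] N_ge2 isT.
rewrite !inE !negb_or => /and3P[ca cv vc].
have sym d : c != letter_inv d -> d != letter_inv c.
  by apply: contraNneq => ->; rewrite letter_invK.
pose q := nseq L c ++ v ++ nseq L c.
have rcv : reduced (nseq L c ++ v).
  case: v rv v0 cv {vc q} => // d v rv _ /= /sym cv; apply: reduced_nseql.
  by apply/andP.
have rvc : reduced (v ++ nseq L c).
  apply: reduced_nseqr; apply: reduced_rcons => //.
  by case: v rv v0 vc {rcv cv q}.
have rq : reduced q by exact: reduced_cat3.
have [u ub uq] := recur rq isT (maxn (tau b) 1).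
move: ub; rewrite geq_max => /andP[ub u1]; pose n := size u.
have WE p s : u ++ q = p ++ s -> W (size p) = p.
  move=> e; have [sp _ cp] := WP (size p); apply: (cylinder_inj cp) => //.
  by apply: (@cylinder_catl _ _ p s); rewrite -e.
have Whead m : (0 < m)%N -> head a (W m) = a.
  move=> m0; have [sm _ cm] := WP m; have [s1 _ c1] := WP 1%N.
  have e : take 1 (W m) = W 1%N.
    by have := cylinder_prefix c1 cm; rewrite s1 sm; exact.
  rewrite /a -e; by case: (W m) sm.
have cyc m : (0 < m)%N -> last c (W m) = c -> reduced (W m ++ W m).
  move=> m0 lc; have [sm rm _] := WP m.
  apply: (cyclically_reduced rm (sym _ ca)) => //; first exact: Whead.
  by rewrite -size_eq0 sm -lt0n.
have stab k : reduced (W (tau k) ++ W (tau k)) ->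
    k%:R - K%:R <= stable_length R S (conj_class (fgw (W (tau k)))).
  move=> rw; apply: le_trans (stable_length_ge R genS KP rw).
  by rewrite lerD2r ler_nat; case/andP: (tau_wl k).
have last_c m p : (0 < m)%N -> last c (p ++ nseq m c) = c.
  by case: m => // m _; rewrite last_cat /=; elim: m.
have [k /andP[nk kL]] := tau_dense n.
have [k' /andP[nk' kL']] := tau_dense (n + (L + size v))%N.
pose i := (tau k - n)%N; pose i' := (tau k' - (n + (L + size v)))%N.
have iL : (0 < i <= L)%N by rewrite /i; lia.
have iL' : (0 < i' <= L)%N by rewrite /i'; lia.
pose w := u ++ nseq i c; pose w' := w ++ nseq (L - i) c ++ v ++ nseq i' c.
have cE j : (j <= L)%N -> nseq L c = nseq j c ++ nseq (L - j) c.
  by move=> jL; rewrite -nseqD subnKC.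
have wE : W (tau k) = w.
  have -> : tau k = size w by rewrite /w size_cat size_nseq /i -/n; lia.
  apply: (WE _ (nseq (L - i) c ++ v ++ nseq L c)).
  by rewrite /w /q {1}(cE i) ?(andP iL).2 // -!catA.
have wE' : W (tau k') = w'.
  have -> : tau k' = size w'.
    by rewrite /w' /w !size_cat !size_nseq /i' -/n; lia.
  apply: (WE _ (nseq (L - i') c)).
  rewrite /w' /w /q {1}(cE i) ?(andP iL).2 // (cE i') ?(andP iL').2 //.
  by rewrite -!catA.
have tk0 : (0 < tau k)%N by exact: leq_ltn_trans nk.
have tk0' : (0 < tau k')%N by exact: leq_ltn_trans nk'.
have rw : reduced (W (tau k) ++ W (tau k)).
  by apply: cyc => //; rewrite wE /w last_c //; case/andP: iL.
have rw' : reduced (W (tau k') ++ W (tau k')).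
  by apply: cyc => //; rewrite wE' /w' !catA last_c //; case/andP: iL'.
have tau_lt m1 m2 : (tau m1 < tau m2)%N -> (m1 < m2)%N.
  by move=> h; rewrite ltnNge; apply/negP => /tau_homo; rewrite leqNgt h.
exists k, k'; split; rewrite ?stab //.
- by apply/ltnW/tau_lt; apply: leq_ltn_trans nk.
- by apply: tau_lt; apply: leq_ltn_trans nk';
  rewrite (leq_trans kL) // leq_add2l leq_addr.
exists w, (nseq (L - i) c), (nseq i' c); split;
  rewrite ?size_nseq -/w' -?wE' -?wE //.
by rewrite leq_subr; case/andP: iL'.
Qed.

End LongPatterns.

(** * Spectrally rigid rays *)

Theorem theorem4p5 (R : realType) (N : nat) (N_ge2 : (2 <= N)%N)
    (S : {fset free_group N}) (genS : generates S)
    (nu : probability (boundary N_ge2) R) (PSnu : patterson_sullivan S nu) :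
  exists2 D : R, 0 < D &
    {ae nu, forall xi : boundary N_ge2, exists x : nat -> free_group N,
      [/\ rough_geodesic_ray S D x,
          x 0%N = 1%g,
          converges_to x xi,
          (forall m : nat, (1 <= m)%N ->
            spectrally_rigid R
              [set conj_class (x k) | k in [set k : nat | (m <= k)%N]]) &
          (forall f : R -> R,
            (forall T, 0 < T -> 0 < f T) -> f T @[T --> +oo] --> +oo ->
            exists n : nat -> nat,
              (forall i j : nat, (i < j)%N -> (n i < n j)%N) /\
              let E := [set conj_class (x (n k)) | k in [set k : nat | (1 <= k)%N]] in
              spectrally_rigid R E /\
              forall T : R, 0 < T ->
                let ET := [set c | E c /\ stable_length R S c < T] in
                finite_set ET /\ (#|` fset_set ET|%fset)%:R <= f T)]}.
Proof.
have [M MP] := word_length_fgsize genS; have [K KP] := word_length_cat genS.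
exists (M + K).+1%:R; first by rewrite ltr0n.
apply: filterS (words_recur genS PSnu) => xi recur.
have [W [tau [WP tau0 tau_homo tau_wl tau_dense]]] := rough_ray genS MP KP xi.
pose x k := fgw (W (tau k)).
have dist j k : (j <= k)%N -> (k <= word_dist S (x j) (x k) + j + M)%N /\
    (word_dist S (x j) (x k) + j <= k + M + K)%N.
  move=> /tau_homo jk; have [sj _ cj] := WP (tau j); have [sk rk ck] :=
    WP (tau k).
  have := cylinder_prefix cj ck; rewrite sj sk => /(_ jk) e.
  have kE : W (tau k) = W (tau j) ++ drop (tau j) (W (tau k)).
    by rewrite -[in LHS](cat_take_drop (tau j) (W (tau k))) e.
  have dE : word_dist S (x j) (x k) =
    word_length S (fgw (drop (tau j) (W (tau k)))).
    by rewrite /word_dist /x {1}kE fgw_cat mulKg.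
  move: rk; rewrite kE => /KP; rewrite -kE -dE.
  have := word_lengthM genS (x j) ((x j)^-1 * x k)%g;
    rewrite mulVKg -/(word_dist S _ _).
  move: (tau_wl j) (tau_wl k) => /andP[j1 j2] /andP[k1 k2];
    rewrite -/(x j) -/(x k) in j1 j2 k1 k2 *.
  by move=> h1 h2; split; lia.
have good v b := ray_differ_by R genS KP WP tau_homo tau_wl tau_dense recur
  (v := v) b.
exists x; split.
- suff H j k : (j <= k)%N ->
      k%:R - j%:R - (M + K).+1%:R <= (word_dist S (x j) (x k))%:R :> R /\
      (word_dist S (x j) (x k))%:R <= k%:R - j%:R + (M + K).+1%:R :> R.
    move=> m n; have [mn|/ltnW nm] := leqP n m.
      have [h1 h2] := H n m mn; rewrite ger0_norm; first by rewrite h1 h2.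
      by rewrite subr_ge0 ler_nat.
    have [h1 h2] := H m n nm; rewrite ler0_norm;
      last by rewrite subr_le0 ler_nat.
    rewrite opprB; move: h1 h2.
    have -> : word_dist S (x n) (x m) = word_dist S (x m) (x n).
      by rewrite /word_dist -(word_lengthV genS) invgM invgK.
    by move=> -> ->.
  move=> /dist[]; rewrite -!(ler_nat R) !natrD -[(M + K).+1]addn1 !natrD.
  have : 0 <= K%:R :> R by []; lra.
- by rewrite /x tau0; have [/size0nil -> _ _] := WP 0%N; rewrite fgw0.
- apply: converges_prefixes => [k|n].
    by have [_ rk ck] := WP (tau k); rewrite val_fgw.
  exists (M * n).+1 => k kn; have [sk rk _] := WP (tau k).
  rewrite fgsize_fgw // sk ltnW // ltnNge; apply/negP => h.
  have := leq_trans (andP (tau_wl k)).1 (MP _); rewrite fgsize_fgw // sk.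
  move=> /(leq_trans kn); rewrite ltn_mul2l => /andP[_].
  by rewrite ltnNge h.
- move=> m _; apply: (differ_by_rigid N_ge2) => v rv v0.
  have [k [k' [mk kk' g _ _]]] := good v m rv v0.
  by exists k, k'; split; [exact: mk|exact: leq_trans mk (ltnW kk')|exact: g].
- move=> f f0 foo; pose v0 : seq ('I_N * bool) := [:: (Ordinal N_ge2, true)].
  pose P (v : seq ('I_N * bool)) k k' := reduced v -> v != [::] ->
    differ_by (max_gen_size S * K).+1 x v k k'.
  have [|n [n_homo nP nf]] := @sparse_subsequence R (seq ('I_N * bool)) v0 P
    (fun k => stable_length R S (conj_class (x k))) K _ f foo.
    move=> v b; have [[rv vn0]|nv] := pselect (reduced v /\ v != [::]).
      have [k [k' [h1 h2 h3 h4 h5]]] := good v b rv vn0.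
      by exists k, k'; split=> //= _ _.
    have [k [k' [h1 h2 h3 h4 h5]]] := good v0 b isT isT.
    by exists k, k'; split=> //= rv vn0; case: nv.
  exists n; split; first exact: n_homo.
  split.
    have -> : [set conj_class (x (n k)) | k in [set k | (1 <= k)%N]] =
        [set conj_class (x k) | k in n @` [set k | (1 <= k)%N]]
          by rewrite image_comp.
    apply: (differ_by_rigid N_ge2) => v rv vn0; have [i [j [i1 j1 g]]] := nP v.
    by exists (n i), (n j); split; [exists i|exists j|exact: g].
  move=> T T0; set ET := [set c | _ /\ _]; pose I :=
    [seq conj_class (x (n i)) | i <- iota 1 (Num.truncn (f T))].
  have fT0 : 0 <= f T by rewrite ltW ?f0.
  have EI : ET `<=` [set` I].
    move=> c [[i i1 <-] lt] /=; apply/mapP; exists i => //.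
    by rewrite mem_iota i1 add1n ltnS truncn_ge_nat // (nf i T i1 lt).
  have fin : finite_set ET by apply: sub_finite_set EI _; exact: finite_seq.
  split=> //; rewrite -truncn_ge_nat //.
  rewrite -(size_iota 1 (Num.truncn (f T)))
    -(size_map (fun i => conj_class (x (n i)))).
  apply: uniq_leq_size => [|c]; first exact: fset_uniq.
  by rewrite in_fset_set // inE => /EI.
Qed.
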